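(* Let $d=1$, let $\tilde\Delta$ be an approximation function, let $f\in\mathcal B_{\tilde\Delta}$, and let $\rho\in\mathbb T^1$ be nonresonant in the continuous sense. Assume $$\sum_{k\in\mathbb Z,\ k\ne0}\frac1{\tilde\Delta(|k|)}<+\infty .$$ Then there exist $\hat c>0$ and $C_8>0$, independent of $T$, such that for all sufficiently large real $T$ and all $\theta\in\mathbb T^1$ $$\left\|\frac1T\int_0^T\bar w(t/T)\,f(\rho t+\theta)\,dt-\int_{\mathbb T^1}f(\hat\theta)\,d\hat\theta\right\|_{\mathcal B}\le C_8\exp\left(-T^{\hat c}\right).$$
   Context: An approximation function is a continuous, strictly increasing function $\Delta:[1,+\infty)\to[1,+\infty)$ with $\Delta(+\infty)=+\infty$. $\mathbb T^1=\mathbb R/\mathbb Z$ with normalized Lebesgue measure; $\rho\in\mathbb T^1$ is identified with a fixed representative in $\mathbb R$. The irrational $\rho$ is nonresonant in the continuous sense if there are $\alpha>0$ and an approximation function $\Delta$ with $|k\rho|\ge\alpha/\Delta(|k|)$ for all $0\ne k\in\mathbb Z$. $(\mathcal B,\|\cdot\|_{\mathcal B})$ is a Banach (function) space, possibly infinite-dimensional, over complex scalars. $\mathcal B_{\tilde\Delta}$ (with $d=1$) is the set of $f:\mathbb T^1\to\mathcal B$ such that $f(\theta)=\sum_{k\in\mathbb Z}\hat f_k e^{2\pi i k\theta}$ for every $\theta$ (equality in the norm of $\mathcal B$), where $\hat f_k=\int_{\mathbb T^1}f(\hat\theta)e^{-2\pi i k\hat\theta}\,d\hat\theta$, and $\sup_{0\ne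 k\in\mathbb Z}\tilde\Delta(|k|)\,\|\hat f_k\|_{\mathcal B}<+\infty$. The weighting function is $$\bar w(x)=\left(\int_0^1\exp\left(-s^{-1}(1-s)^{-1}\right)ds\right)^{-1}\exp\left(-x^{-1}(1-x)^{-1}\right)\ \text{ on }(0,1),\qquad \bar w(0)=\bar w(1)=0.$$ *)

(* Defs.v *)
From HB Require Import structures.
From mathcomp Require Import all_boot all_order all_algebra.
From mathcomp Require Import all_classical all_reals all_analysis.
From mathcomp Require Import complex.

Set Implicit Arguments.
Unset Strict Implicit.
Unset Printing Implicit Defensive.

Import Order.TTheory GRing.Theory Num.Theory.
Import numFieldNormedType.Exports.

Local Open Scope classical_set_scope.
Local Open Scope ring_scope.
Local Open Scope complex_scope.

Section Bochner.
Context d (T : measurableType d) (R : realType) (B : completeNormedModType R[i]).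
Variables (mu : {measure set T -> \bar R}) (D : set T).

Definition bochner_simple (s : T -> B) : Prop :=
  [/\ finite_set (range s),
      forall b, measurable (s @^-1` [set b]) &
      forall b, b != 0 -> (mu (D `&` s @^-1` [set b]) < +oo)%E].

(* If D has infinite measure, the junk value of fine only affects b = 0. *)
Definition bochner_simple_integral (s : T -> B) : B :=
  \sum_(b \in range s) (fine (mu (D `&` s @^-1` [set b])))%:C *: b.

(* The norm of B takes its values in the nonnegative reals of R[i]; complex.Re
   reads them back in R. *)
Definition is_bochner_integral (g : T -> B) (v : B) : Prop :=
  exists s : nat -> T -> B,
    [/\ forall n, bochner_simple (s n),
        {ae mu, forall x, D x -> s n x @[n --> \oo] --> g x},
        (\int[mu]_(x in D) (complex.Re `|g x - s n x|)%:E)%E @[n --> \oo]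
          --> 0%E &
        bochner_simple_integral (s n) @[n --> \oo] --> v].

Definition bochner_integrable (g : T -> B) : Prop :=
  exists v, is_bochner_integral g v.

(* The Bochner integral of g over D, and 0 when g is not integrable. *)
Definition bochner_integral (g : T -> B) : B :=
  xget 0 [set v | is_bochner_integral g v].

End Bochner.

Section Defs.
Context (R : realType).

Definition approximation_function (Delta : R -> R) : Prop :=
  [/\ {within `[1, +oo[, continuous Delta},
      {in `[1, +oo[ &, {homo Delta : x y / x < y}},
      forall x, 1 <= x -> 1 <= Delta x &
      Delta x @[x --> +oo] --> +oo].

Definition nonresonant_continuous (rho : R) : Prop :=
  irrational rho /\
  exists2 alpha : R, 0 < alpha &
  exists2 Delta : R -> R, approximation_function Delta &
  forall k : int, k != 0 ->
    alpha / Delta (`|k|%:~R) <= `|k%:~R * rho|.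

Definition expi (x : R) : R[i] := cos x +i* sin x.

Definition wbar (x : R) : R :=
  if 0 < x < 1 then
    (\int[lebesgue_measure]_(s in `]0%R, 1%R[) expR (- (s^-1 * (1 - s)^-1)))^-1
      * expR (- (x^-1 * (1 - x)^-1))
  else 0.

Context (B : completeNormedModType R[i]).

(* Functions on the circle R/Z are 1-periodic functions on R, and the
   normalized Lebesgue measure of R/Z is lebesgue_measure on `[0, 1]. *)
Definition circle_integral (f : R -> B) : B :=
  bochner_integral lebesgue_measure `[0, 1] f.

Definition fourier_coef (f : R -> B) (k : int) : B :=
  circle_integral (fun x => expi (- (2 * pi * k%:~R * x)) *: f x).

(* The sum over all k with - n <= k <= n. *)
Definition fourier_partial_sum (f : R -> B) (n : nat) (x : R) : B :=
  \sum_(j < n.*2.+1)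
    let k : int := j%:Z - n%:Z in
    expi (2 * pi * k%:~R * x) *: fourier_coef f k.

Definition in_B_Delta (Delta : R -> R) (f : R -> B) : Prop :=
  [/\ forall x, f (x + 1) = f x,
      bochner_integrable lebesgue_measure `[0, 1] f,
      forall x, fourier_partial_sum f n x @[n --> \oo] --> f x &
      (ereal_sup [set (Delta (`|k|%:~R) * complex.Re `|fourier_coef f k|)%:E
                   | k in [set k : int | k != 0%R]] < +oo)%E].

End Defs.

(* Main.v *)
Require Import Defs.
From HB Require Import structures.
From mathcomp Require Import all_boot all_order all_algebra.
From mathcomp Require Import finmap.
From mathcomp Require Import all_classical all_reals all_analysis.
From mathcomp Require Import measurable_realfun.
From mathcomp Require Import complex.
From mathcomp Require Import ring.

(** In dimension one |k rho| >= |rho| > 0 for every nonzero integer k: there are no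
    small divisors, and only the smoothness of the weight limits the rate.

    Write w for the weight and a = rho T.  After the substitution t = T x the
    average becomes the integral over [0, 1] of w(x) f(a x + theta).  The
    Fourier series of f converges absolutely, because the norms of the
    coefficients are dominated by 1 / Delta(|k|); the mode k = 0 contributes
    exactly the integral of f, since w has mass 1, and the mode k contributes its
    coefficient times the Fourier integral of w at frequency
    lambda = 2 pi k a, of modulus at least 2 pi |rho| T.  Everything thus rests
    on the decay of this scalar integral.

    With u = 1/x and v = 1/(1-x), the weight is a multiple of exp(-u-v), and the
    functions F_(a,b) = u^a v^b exp(-u-v), extended by 0, are closed under
    differentiation:
      F_(a,b)' = - a F_(a+1,b) + b F_(a,b+1) + F_(a+2,b) - F_(a,b+2).
    They vanish at both ends and satisfy F_(a,b) <= a! b!.  Integrating by parts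
    m times (limsup_rsum_osc) bounds the Fourier integral of exp(-u-v) by
    (2m)! (2m)^m / |lambda|^m <= ((2m)^3 / |lambda|)^m.  Choosing
    (2m)^3 <= |lambda| / e makes this at most exp(-m) (osc_decay), and one may
    take m about T^(1/4) (exp_decay_eventually), whence the exponent 1/4.

    All integrals are reached through left Riemann sums on the grid j/n, which
    are linear and make sense for scalar and for vector-valued functions alike.
    A uniformly continuous function is Bochner integrable and its integral is
    the limit of its Riemann sums (is_bochner_integral_unif_cont), because
    step functions on the grid are simple functions converging to it uniformly.
    The choice of a value by bochner_integral is harmless since Bochner integrals
    are unique (is_bochner_integral_unique).  Integration by parts is the statement
    that the Riemann sums of H' tend to H(1) - H(0) (rsum_derive). *)

Set Implicit Arguments.
Unset Strict Implicit.
Unset Printing Implicit Defensive.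

Import Order.TTheory GRing.Theory Num.Theory.
Import numFieldNormedType.Exports.

Local Open Scope classical_set_scope.
Local Open Scope ring_scope.
Local Open Scope complex_scope.

(** * Real calculus and Riemann sums *)

Section RealCalculus.
Context (R : realType).
Implicit Types (f g : R -> R) (x y : R).

Lemma is_derive_continuous f f' :
  (forall x, is_derive x 1 f (f' x)) -> continuous f.
Proof.
move=> df x; apply: differentiable_continuous.
by apply/derivable1_diffP; have [] := df x.
Qed.

Lemma MVT_everywhere f f' x y : (forall x, is_derive x 1 f (f' x)) -> x <= y ->
  exists2 c, x <= c <= y & f y - f x = f' c * (y - x).
Proof.
move=> df xy.
have [|c] := @MVT_segment R f f' x y xy (fun z _ => df z).
  by apply: continuous_subspaceT; exact: is_derive_continuous df.
by rewrite in_itv /=; exists c.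
Qed.

Definition lipschitzR f := exists2 L, 0 <= L &
  forall x y, `|f x - f y| <= L * `|x - y|.

Lemma lipschitzR_derive f f' L : (forall x, is_derive x 1 f (f' x)) ->
  (forall x, `|f' x| <= L) -> lipschitzR f.
Proof.
move=> df bf; exists L; first exact: le_trans (bf 0).
move=> x y; wlog xy : x y / x <= y => [H|].
  by have [/H//|/ltW/H] := leP x y; rewrite distrC (distrC y).
have [c _ e] := MVT_everywhere df xy.
by rewrite distrC e normrM (distrC x) ler_wpM2r.
Qed.

Lemma lipschitzRZ f a : lipschitzR f -> lipschitzR (fun x => a * f x).
Proof.
move=> [L L0 fL]; exists (`|a| * L); first by rewrite mulr_ge0.
by move=> x y; rewrite -mulrBr normrM -mulrA ler_wpM2l.
Qed.

Lemma lipschitzRD f g :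
  lipschitzR f -> lipschitzR g -> lipschitzR (fun x => f x + g x).
Proof.
move=> [L L0 fL] [M M0 gM]; exists (L + M); first by rewrite addr_ge0.
move=> x y; rewrite opprD addrACA mulrDl.
by rewrite (le_trans (ler_normD _ _))// lerD.
Qed.

(** Gives the derivative of a flat bump at points where its defining formula does
    not apply, the two ends of its support included. *)
Lemma is_derive_quadratic f x C :
  (forall y, `|f y - f x| <= C * (y - x) ^+ 2) -> is_derive x 1 f 0.
Proof.
move=> fC.
have C0 : 0 <= C.
  have := fC (x + 1); rewrite addrAC subrr add0r expr1n mulr1.
  exact: le_trans.
have H : h^-1 *: (f (h *: 1 + x) - f x) @[h --> 0^'] --> (0 : R).
  apply/cvgrPdist_le => e e0; near=> h.
  have h0 : h != 0 by near: h; exact: nbhs_dnbhs_neq.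
  rewrite sub0r normrN /GRing.scale /= normrM mulr1.
  have := fC (h + x); rewrite addrK => fh.
  have nh0 : 0 < `|h| by rewrite normr_gt0.
  rewrite normfV ler_pdivrMl//; apply: (le_trans fh).
  rewrite -real_normK ?num_real// expr2 mulrCA ler_pM2l//.
  have : `|h| <= e / (C + 1).
    near: h; apply: dnbhs0_le; apply: divr_gt0 => //.
    by rewrite ltr_wpDl.
  rewrite ler_pdivlMr ?ltr_wpDl// mulrC => /(le_trans _); apply.
  by rewrite ler_wpM2r// lerDl.
split; first by apply/cvg_ex; exists 0.
exact/cvg_lim.
Unshelve. all: by end_near. Qed.

Definition rsum (n : nat) f : R :=
  n%:R^-1 * \sum_(j < n) f (j%:R / n%:R).

Lemma rsumD n f g : rsum n (fun x => f x + g x) = rsum n f + rsum n g.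
Proof. by rewrite /rsum big_split mulrDr. Qed.

Lemma rsumZ n a f : rsum n (fun x => a * f x) = a * rsum n f.
Proof. by rewrite /rsum -mulr_sumr mulrCA. Qed.

Lemma rsum_le n f M : (0 < n)%N -> (forall x, 0 <= x <= 1 -> `|f x| <= M) -> `|rsum n f| <= M.
Proof.
move=> n0 fM; rewrite /rsum normrM normfV normr_nat ler_pdivrMl ?ltr0n//.
rewrite (le_trans (ler_norm_sum _ _ _))//.
apply: (@le_trans _ _ (\sum_(j < n) M)).
  apply: ler_sum => j _; apply: fM.
  rewrite divr_ge0//= ler_pdivrMr ?ltr0n// mul1r ler_nat; exact: ltnW.
by rewrite sumr_const card_ord mulr_natl.
Qed.

(** On each cell the mean value theorem replaces the increment of f by f' at some
    point of the cell, and moving that point to the left end costs L / n; the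
    increments telescope.  This is the fundamental theorem of calculus for
    Riemann sums, and with f(0) = f(1) it is integration by parts. *)
Lemma rsum_derive f f' L :
  (forall x, 0 <= x <= 1 -> is_derive x 1 f (f' x)) ->
  (forall x y, `|f' x - f' y| <= L * `|x - y|) ->
  forall n, (0 < n)%N -> `|rsum n f' - (f 1 - f 0)| <= L / n%:R.
Proof.
move=> df lf n n0.
have n0' : 0 < n%:R :> R by rewrite ltr0n.
pose p (j : nat) : R := j%:R / n%:R.
have L0 : 0 <= L.
  have := lf 1 0; rewrite subr0 normr1 mulr1; exact: le_trans.
have -> : f 1 - f 0 = \sum_(j < n) (f (p j.+1) - f (p j)).
  rewrite -(big_mkord xpredT (fun j => f (p j.+1) - f (p j))).
  by rewrite telescope_sumr// /p divff ?gt_eqF// mul0r.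
rewrite /rsum mulr_sumr -sumrB (le_trans (ler_norm_sum _ _ _))//.
apply: (@le_trans _ _ (\sum_(j < n) (L / n%:R ^+ 2))); last first.
  rewrite sumr_const card_ord -[X in X *+ _]mulr1 -mulrnAr.
  by rewrite expr2 invfM mulrA -mulrA mulVf ?gt_eqF// mulr1.
apply: ler_sum => j _; rewrite -/(p j).
have pS : p j.+1 - p j = n%:R^-1.
  by rewrite /p -mulrBl -natrB// subSnn mul1r.
have pj : p j <= p j.+1 by rewrite -subr_ge0 pS invr_ge0 ltW.
have p0 : 0 <= p j by rewrite divr_ge0.
have p1 : p j.+1 <= 1 by rewrite ler_pdivrMr// mul1r ler_nat.
have inI x : x \in `[p j, p j.+1] -> 0 <= x <= 1.
  by rewrite in_itv/= => /andP[a b]; rewrite (le_trans p0)//= (le_trans b).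
have [x xI||c cI ->] := @MVT_segment R f f' (p j) (p j.+1) pj.
- apply/df/inI; apply: subset_itv_oo_cc xI.
- apply: derivable_within_continuous => x /inI xI.
  by have [] := df _ xI.
rewrite pS mulrC -mulrBl normrM normfV normr_nat expr2 invfM mulrA.
rewrite ler_pM2r ?invr_gt0//.
move: cI; rewrite in_itv /= => /andP[c1 c2].
rewrite (le_trans (lf _ _))// ler_wpM2l// -pS distrC ger0_norm ?subr_ge0//.
by rewrite lerB.
Qed.

End RealCalculus.

(** * The flat bump and its oscillating products *)

Section Bump.
Context (R : realType).
Implicit Types (x y : R) (a b : nat).

Lemma is_derive_fun_inv (f : R -> R) df x : f x != 0 -> is_derive x 1 f df ->
  is_derive x 1 (fun y => (f y)^-1) (- (f x) ^- 2 * df).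
Proof.
move=> fx [fd <-]; split; first exact: derivableV.
by rewrite deriveV.
Qed.

Lemma is_derive_fun_mul (f g : R -> R) df dg x :
  is_derive x 1 f df -> is_derive x 1 g dg ->
  is_derive x 1 (fun y => f y * g y) (df * g x + f x * dg).
Proof.
move=> fd gd; apply: (is_derive_eq (is_deriveM fd gd)).
by rewrite /GRing.scale /= addrC (mulrC (g x)).
Qed.

Lemma is_derive_fun_exp (f : R -> R) n df x : is_derive x 1 f df ->
  is_derive x 1 (fun y => f y ^+ n) (n%:R * f x ^+ n.-1 * df).
Proof.
move=> fd; have := is_deriveX n fd.
by congr (is_derive x 1 _ _); apply/funext => y; rewrite exprfctE.
Qed.

(** The functions u^a v^b exp(-u-v) with u = 1/x and v = 1/(1-x).  The weight is a
    multiple of the one with a = b = 0, because 1/(x(1-x)) = u + v; the other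
    exponents are what differentiation produces. *)
Definition flat_bump a b x : R :=
  if 0 < x < 1 then
    x^-1 ^+ a * (1 - x)^-1 ^+ b * expR (- (x^-1 + (1 - x)^-1))
  else 0.

(** u^n / n! is one term of the exponential series of u. *)
Lemma exp_fact_le (u : R) n : 0 <= u -> u ^+ n * expR (- u) <= n`!%:R.
Proof.
move=> u0; rewrite expRN ler_pdivrMr ?expR_gt0//.
case: n => [|n]; first by rewrite expr0 fact0 mul1r -expR0 ler_expR.
have := expR_ge1Dxn n u0; rewrite addrC -lerBrDr.
rewrite ler_pdivrMr ?ltr0n ?fact_gt0// mulrC => /le_trans; apply.
by rewrite ler_wpM2l// gerBl.
Qed.

Lemma flat_bump_ge0 a b x : 0 <= flat_bump a b x.
Proof.
rewrite /flat_bump; case: ifP => // /andP[x0 x1].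
by rewrite !mulr_ge0 ?exprn_ge0 ?expR_ge0 ?invr_ge0 ?subr_ge0// ltW.
Qed.

Lemma flat_bump_le a b x : flat_bump a b x <= (a`! * b`!)%:R.
Proof.
rewrite /flat_bump; case: ifP => // /andP[x0 x1].
have u0 : 0 <= x^-1 by rewrite invr_ge0 ltW.
have v0 : 0 <= (1 - x)^-1 by rewrite invr_ge0 subr_ge0 ltW.
rewrite opprD expRD mulrACA natrM ler_pM ?exp_fact_le//;
  by rewrite mulr_ge0 ?exprn_ge0 ?expR_ge0.
Qed.

Lemma normr_flat_bump_le a b x : `|flat_bump a b x| <= (a`! * b`!)%:R.
Proof. by rewrite ger0_norm ?flat_bump_ge0 ?flat_bump_le. Qed.

Lemma flat_bump_sym a b x : flat_bump a b (1 - x) = flat_bump b a x.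
Proof.
rewrite /flat_bump subKr subr_gt0 gtrBl andbC.
by case: ifP => // _; rewrite (mulrC (_ ^+ a)) (addrC (_^-1)).
Qed.

(** The factor x^2 is traded for u^-2, so that the bound is the uniform one for the
    exponent a + 2. *)
Lemma flat_bump_sqr_le a b x : flat_bump a b x <= (a.+2`! * b`!)%:R * x ^+ 2.
Proof.
have [|xI] := boolP (0 < x < 1); last first.
  by rewrite /flat_bump (negbTE xI) mulr_ge0// sqr_ge0.
move=> xI; have -> : flat_bump a b x = flat_bump a.+2 b x * x ^+ 2.
  rewrite /flat_bump xI; case/andP: xI => x0 x1.
  have xn0 : x != 0 by rewrite gt_eqF.
  rewrite -[LHS]mul1r -(expr1n _ 2) -(mulVf xn0) !exprS; ring.
by rewrite ler_wpM2r ?sqr_ge0 ?flat_bump_le.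
Qed.

Definition dflat_bump a b x : R :=
  - a%:R * flat_bump a.+1 b x + b%:R * flat_bump a b.+1 x + flat_bump a.+2 b x - flat_bump a b.+2 x.

(** Inside (0, 1) this is the product rule, with u' = - u^2 and v' = v^2.
    Outside, the function vanishes quadratically at every point, either trivially
    or by flat_bump_sqr_le at the left end and its mirror image at the right
    end. *)
Lemma is_derive_flat_bump a b x : is_derive x 1 (flat_bump a b) (dflat_bump a b x).
Proof.
have [xI|xI] := boolP (0 < x < 1); last first.
  have -> : dflat_bump a b x = 0.
    by rewrite /dflat_bump /flat_bump (negbTE xI) !mulr0 subr0 !addr0.
  have bx : flat_bump a b x = 0 by rewrite /flat_bump (negbTE xI).
  move: xI; rewrite negb_and -!leNgt => /orP[x0|x1].
    apply: (@is_derive_quadratic _ _ _ (a.+2`! * b`!)%:R) => y.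
    rewrite bx subr0 ger0_norm ?flat_bump_ge0//.
    have [y0|y0] := leP y 0.
      by rewrite /flat_bump ltNge y0 /= mulr_ge0 ?sqr_ge0.
    apply: (le_trans (flat_bump_sqr_le _ _ _)).
    have yx : y <= y - x by rewrite lerDl oppr_ge0.
    by rewrite ler_wpM2l// lerXn2r ?nnegrE ?(le_trans _ yx)// ltW.
  apply: (@is_derive_quadratic _ _ _ (b.+2`! * a`!)%:R) => y.
  rewrite bx subr0 ger0_norm ?flat_bump_ge0//.
  have [y0|y0] := leP 1 y.
    by rewrite /flat_bump (ltNge y) y0 andbF mulr_ge0 ?sqr_ge0.
  rewrite -(subKr 1 y) flat_bump_sym; apply: (le_trans (flat_bump_sqr_le _ _ _)).
  have yx : 1 - y <= x - y by rewrite lerB.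
  have y1 : 0 <= 1 - y by rewrite subr_ge0 ltW.
  by rewrite ler_wpM2l// subKr -[leRHS]sqrrN opprB lerXn2r ?nnegrE// (le_trans y1).
case/andP: (xI) => x0 x1.
pose g := fun y : R => y^-1 ^+ a * (1 - y)^-1 ^+ b * expR (- (y^-1 + (1 - y)^-1)).
have gE : \forall y \near x, g y = flat_bump a b y.
  near=> y; rewrite /flat_bump ifT//; apply/andP; split.
    by near: y; exact: lt_nbhsr.
  by near: y; exact: lt_nbhsl.
apply: (near_eq_is_derive gE).
have xn0 : x != 0 by rewrite gt_eqF.
have yn0 : 1 - x != 0 by rewrite gt_eqF// subr_gt0.
have du := is_derive_fun_inv xn0 (is_derive_id x 1).
have dv : is_derive x 1 (fun y : R => (1 - y)^-1) ((1 - x) ^- 2).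
  have d1 : is_derive x 1 (fun y : R => 1 - y) (-1).
    apply: (is_derive_eq (is_deriveB (is_derive_cst (1 : R) x 1) (is_derive_id x (1:R)))).
    by rewrite sub0r.
  by have /= := @is_derive_fun_inv (fun y => 1 - y) _ _ yn0 d1; rewrite mulrN1 opprK.
have d3 := is_derive1_comp (is_derive_expR _) (is_deriveN (is_deriveD du dv)).
have d4 := is_derive_fun_mul (is_derive_fun_mul (is_derive_fun_exp a du) (is_derive_fun_exp b dv)) d3.
apply: (is_derive_eq d4).
rewrite /dflat_bump /flat_bump xI.
set E := expR _.
have eV : (1 - x) ^- 2 = (1 - x)^-1 ^+ 2 by rewrite exprVn.
have eU : x ^- 2 = x^-1 ^+ 2 by rewrite exprVn.
rewrite eU eV; set u := x^-1; set v := (1 - x)^-1.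
have aE (n : nat) (z : R) : n%:R * z ^+ n.-1 * z ^+ 2 = n%:R * z ^+ n.+1.
  by case: n => [|n]; rewrite ?mul0r// -mulrA -exprD addn2.
rewrite [id x]/= mulr1 mulrN !aE /= -/E.
by rewrite !exprS; ring.
Unshelve. all: by end_near. Qed.

(** An arbitrary phase p is kept so that a single family is stable under
    differentiation: the derivative of a cosine is again a cosine, with the
    phase advanced by pi/2.  It also absorbs the translation by theta. *)
Definition osc l a b p x : R := flat_bump a b x * cos (l * x + p).

Definition dosc l a b p x : R :=
  - a%:R * osc l a.+1 b p x + b%:R * osc l a b.+1 p x
  + osc l a.+2 b p x - osc l a b.+2 p x + l * osc l a b (p + pi / 2) x.

Lemma normr_osc_le l a b p x : `|osc l a b p x| <= (a`! * b`!)%:R.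
Proof.
rewrite normrM -[leRHS]mulr1 ler_pM ?normr_flat_bump_le//.
by rewrite ler_norml cos_le1 cos_geN1.
Qed.

Lemma is_derive_osc l a b p x : is_derive x 1 (osc l a b p) (dosc l a b p x).
Proof.
have d1 : is_derive x 1 (fun y => l * y + p) l.
  have := is_deriveD (is_deriveZ l (is_derive_id x 1)) (is_derive_cst p x 1).
  by rewrite addr0 /GRing.scale /= mulr1.
have d2 := @is_derive1_comp _ _ (fun y => l * y + p) _ _ _ (is_derive_cos (l * x + p)) d1.
have /= d3 := is_derive_fun_mul (is_derive_flat_bump a b x) d2.
apply: (is_derive_eq d3).
by rewrite /dosc /osc addrA cosDpihalf /dflat_bump; ring.
Qed.

Lemma lipschitzR_osc l a b p : lipschitzR (osc l a b p).
Proof.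
pose M := a%:R * (a.+1`! * b`!)%:R + b%:R * (a`! * b.+1`!)%:R +
  (a.+2`! * b`!)%:R + (a`! * b.+2`!)%:R + `|l| * (a`! * b`!)%:R : R.
apply: (@lipschitzR_derive _ _ _ M (is_derive_osc l a b p)) => x.
rewrite /dosc; do !(apply: (le_trans (ler_normD _ _)); apply: lerD).
- by rewrite normrM normrN normr_nat ler_wpM2l// normr_osc_le.
- by rewrite normrM normr_nat ler_wpM2l// normr_osc_le.
- exact: normr_osc_le.
- by rewrite normrN normr_osc_le.
- by rewrite normrM ler_wpM2l// normr_osc_le.
Qed.

Lemma lipschitzR_dosc l a b p : lipschitzR (dosc l a b p).
Proof.
rewrite /dosc; do !apply: lipschitzRD; try exact/lipschitzRZ/lipschitzR_osc.
  exact: lipschitzR_osc.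
have := lipschitzRZ (-1) (lipschitzR_osc l a b.+2 p).
by congr lipschitzR; apply/funext => x; rewrite mulN1r.
Qed.

(** The boundary terms of the integration by parts vanish because the bump is 0 at
    both 0 and 1. *)
Lemma rsum_dosc_cvg0 l a b p : rsum n (dosc l a b p) @[n --> \oo] --> 0.
Proof.
have [L L0 dL] := lipschitzR_dosc l a b p.
apply: (@norm_cvg0 _ _ _ _ _ _ _).
apply: (@squeeze_cvgr _ _ _ _ (cst 0) (fun n => L * n%:R^-1)).
- near=> n; rewrite normr_ge0 /=.
  have n0 : (0 < n)%N by near: n; exact: nbhs_infty_gt.
  have := rsum_derive (fun x _ => is_derive_osc l a b p x) dL n0.
  by rewrite /osc /flat_bump !ltxx andbF /= !mul0r subrr subr0.
- exact: cvg_cst.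
- rewrite -[X in _ --> X](mulr0 L); apply: cvgMr.
  apply/gtr0_cvgV0; last exact: cvgr_idn.
  by near=> n; rewrite ltr0n; near: n; exact: nbhs_infty_gt.
Unshelve. all: by end_near. Qed.

(** An upper bound on the limsup, formulated so that the Riemann sums need not be
    known to converge. *)
Definition limsup_le (u : nat -> R) K :=
  forall e, 0 < e -> \forall n \near \oo, u n <= K + e.

Lemma leq_fact_mul a b : (a`! * b`! <= (a + b)`!)%N.
Proof.
have := bin_fact (leq_addr b a); rewrite addKn => <-.
by rewrite leq_pmull// bin_gt0 leq_addr.
Qed.

(** A closed form dominating the recursion
    c(k, m+1) = k c(k+1, m) + 2 c(k+2, m) with c(k, 0) = k!, which counts the
    terms produced by m integrations by parts from exponents of sum k. *)
Definition osc_bound k m : nat := ((k + m.*2)`! * (k + m.*2) ^ m)%N.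

Lemma osc_boundS k m :
  (k * osc_bound k.+1 m + 2 * osc_bound k.+2 m <= osc_bound k m.+1)%N.
Proof.
have bound12 : (osc_bound k.+1 m <= osc_bound k.+2 m)%N.
  have le12 : (k.+1 + m.*2 <= k.+2 + m.*2)%N by rewrite !addSn.
  rewrite /osc_bound leq_mul//; first exact: leq_fact.
  by case: m le12 => // m le12; rewrite leq_exp2r.
apply: (@leq_trans ((k + 2) * osc_bound k.+2 m)).
  by rewrite mulnDl leq_add2r leq_mul2l bound12 orbT.
rewrite /osc_bound expnS mulnCA doubleS !addnS !addSn leq_mul// leq_mul//.
by rewrite addn0 !ltnS leq_addr.
Qed.

(** Each integration by parts gains a factor 1/|l| and replaces exponents (a, b) by
    the four pairs appearing in dosc, of sum at most a + b + 2. *)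
Lemma limsup_rsum_osc l a b p m : l != 0 ->
  limsup_le (fun n => `|rsum n (osc l a b p)|)
    ((osc_bound (a + b) m)%:R / `|l| ^+ m).
Proof.
move=> l0; have nl0 : 0 < `|l| by rewrite normr_gt0.
elim: m a b p => [|m IH] a b p e e0.
  near=> n; rewrite expr0 divr1 /osc_bound muln1 addn0.
  rewrite (@le_trans _ _ (a`! * b`!)%:R)//; last first.
    by rewrite ler_wpDr ?(ltW e0)// ler_nat leq_fact_mul.
  apply: rsum_le => [|x _]; last exact: normr_osc_le.
  by near: n; exact: nbhs_infty_gt.
(* differentiating osc with phase q produces l times osc with phase p *)
pose q := p - pi / 2.
have qE : q + pi / 2 = p by rewrite /q subrK.
(* the error d is made once by dosc, a + b times by the first two neighbours and
   twice by the last two *)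
pose d := e * `|l| / (a + b + 3)%:R.
have d0 : 0 < d by rewrite divr_gt0 ?mulr_gt0// ltr0n addnS.
have rE n : l * rsum n (osc l a b p) = rsum n (dosc l a b q)
    + a%:R * rsum n (osc l a.+1 b q) + (- b%:R) * rsum n (osc l a b.+1 q)
    - rsum n (osc l a.+2 b q) + rsum n (osc l a b.+2 q).
  have -> : rsum n (dosc l a b q) = - a%:R * rsum n (osc l a.+1 b q)
    + b%:R * rsum n (osc l a b.+1 q) + rsum n (osc l a.+2 b q)
    + (-1) * rsum n (osc l a b.+2 q) + l * rsum n (osc l a b p).
    rewrite -!rsumZ -!rsumD; congr rsum; apply/funext => x.
    by rewrite /dosc qE mulN1r.
  ring.
near=> n.
have h0 : `|rsum n (dosc l a b q)| <= d.
  near: n; have /cvgr0_norm_le := rsum_dosc_cvg0 l a b q; exact.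
have h1 : `|rsum n (osc l a.+1 b q)| <= (osc_bound (a + b).+1 m)%:R / `|l| ^+ m + d.
  by rewrite -addSn; near: n; exact: IH.
have h2 : `|rsum n (osc l a b.+1 q)| <= (osc_bound (a + b).+1 m)%:R / `|l| ^+ m + d.
  by rewrite -addnS; near: n; exact: IH.
have h3 : `|rsum n (osc l a.+2 b q)| <= (osc_bound (a + b).+2 m)%:R / `|l| ^+ m + d.
  by rewrite -!addSn; near: n; exact: IH.
have h4 : `|rsum n (osc l a b.+2 q)| <= (osc_bound (a + b).+2 m)%:R / `|l| ^+ m + d.
  by rewrite -!addnS; near: n; exact: IH.
set K1 := (osc_bound (a + b).+1 m)%:R / _ in h1 h2.
set K2 := (osc_bound (a + b).+2 m)%:R / _ in h3 h4.
have K12 : (a + b)%:R * K1 + 2 * K2 <= (osc_bound (a + b) m.+1)%:R / `|l| ^+ m.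
  rewrite /K1 /K2 !mulrA -mulrDl ler_wpM2r// ?invr_ge0 ?exprn_ge0//.
  by rewrite -!natrM -natrD ler_nat osc_boundS.
rewrite exprS invfM mulrCA.
rewrite -(ler_pM2l nl0) -normrM mulrDr mulVKf ?gt_eqF// rE.
apply: (@le_trans _ _ (d + a%:R * (K1 + d) + b%:R * (K1 + d) + (K2 + d) + (K2 + d))).
  rewrite (le_trans (ler_normD _ _))// lerD//.
  rewrite (le_trans (ler_normB _ _))// lerD//.
  rewrite (le_trans (ler_normD _ _))// lerD//; last first.
    by rewrite normrM normrN normr_nat ler_wpM2l.
  rewrite (le_trans (ler_normD _ _))// lerD//.
  by rewrite normrM normr_nat ler_wpM2l.
have dE : (a + b + 3)%:R * d = `|l| * e.
  by rewrite /d mulrC divfK ?(mulrC e)// pnatr_eq0 addnS.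
have -> : d + a%:R * (K1 + d) + b%:R * (K1 + d) + (K2 + d) + (K2 + d) =
  ((a + b)%:R * K1 + 2 * K2) + (a + b + 3)%:R * d by rewrite !natrD; ring.
by rewrite dE lerD2r.
Unshelve. all: by end_near. Qed.

End Bump.

(** * Exponential decay and total mass *)

Lemma leq_fact_exp n : (n`! <= n ^ n)%N.
Proof.
rewrite fact_prod -[X in (_ <= _ ^ X)%N](subn1 n.+1).
rewrite -prod_nat_const_nat big_nat_cond [leqRHS]big_nat_cond.
by apply: leq_prod => i; rewrite andbT ltnS => /andP[].
Qed.

Section Decay.
Context (R : realType).
Implicit Types (x y : R) (a b : nat).

Lemma limsup_leW (u : nat -> R) K K' : K <= K' -> limsup_le u K -> limsup_le u K'.
Proof.
move=> KK uK e e0; apply: filterS (uK e e0) => n /le_trans; apply.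
by rewrite lerD2r.
Qed.

(** Since (2m)! (2m)^m <= ((2m)^3)^m, the hypothesis on m makes each of the m factors
    of the bound at most 1/e. *)
Lemma osc_decay (l p : R) m : (0 < m)%N -> expR 1 * (m.*2)%:R ^+ 3 <= `|l| ->
  limsup_le (fun n => `|rsum n (osc l 0 0 p)|) (expR (- m%:R)).
Proof.
move=> m0 lm.
have l0 : 0 < `|l|.
  by apply: lt_le_trans lm; rewrite mulr_gt0 ?expR_gt0// exprn_gt0// ltr0n double_gt0.
apply: limsup_leW (limsup_rsum_osc 0 0 p m _); last by rewrite -normr_gt0.
rewrite ler_pdivrMr ?exprn_gt0// expRN ler_pdivlMl ?expR_gt0//.
have -> : expR m%:R = expR 1 ^+ m :> R by rewrite -expRM_natl mulr1.
apply: (@le_trans _ _ ((expR 1 * m.*2%:R ^+ 3) ^+ m)); last first.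
  by rewrite lerXn2r// nnegrE ?(ltW l0)// mulr_ge0 ?expR_ge0 ?exprn_ge0.
rewrite exprMn ler_pM2l ?exprn_gt0 ?expR_gt0//.
rewrite -!natrX ler_nat /osc_bound !add0n.
have -> : ((m.*2 ^ 3) ^ m = m.*2 ^ m.*2 * m.*2 ^ m)%N.
  by rewrite -expnM -expnD; congr (_ ^ _)%N; rewrite !mulSn addn0 addnA addnn.
by rewrite leq_mul2r leq_fact_exp orbT.
Qed.

Definition bump_mass : R :=
  \int[lebesgue_measure]_(s in `]0%R, 1%R[) expR (- (s^-1 * (1 - s)^-1)).

Lemma flat_bump00E x : 0 < x < 1 -> flat_bump 0 0 x = expR (- (x^-1 * (1 - x)^-1)).
Proof.
move=> xI; rewrite /flat_bump xI !expr0 !mul1r; case/andP: xI => x0 x1.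
congr (expR (- _)); field.
by rewrite !(gt_eqF x0) subr_eq0 gt_eqF.
Qed.

Lemma wbarE x : wbar x = bump_mass^-1 * flat_bump 0 0 x.
Proof.
rewrite /wbar; case: ifP => xI; first by rewrite flat_bump00E.
by rewrite /flat_bump xI mulr0.
Qed.

(** The Riemann sums are compared with the increment over [0, 1] of a primitive
    based at -1 rather than 0, so that it is differentiable on the whole closed
    interval.  The mean value theorem for that primitive also gives positivity of
    the mass. *)
Lemma rsum_bump_cvg : (rsum n (flat_bump 0 0) @[n --> \oo] --> bump_mass) /\ 0 < bump_mass.
Proof.
have cb : continuous (flat_bump 0 0 : R -> R) := is_derive_continuous (is_derive_flat_bump 0 0).
have ib (x y : R) : lebesgue_measure.-integrable `[x, y] (EFin \o flat_bump 0 0).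
  apply: continuous_compact_integrable; first exact: segment_compact.
  exact: continuous_subspaceT.
pose G x := (\int[lebesgue_measure]_(t in `[(-1)%R, x]) flat_bump 0 0 t)%R : R.
have dG x : 0 <= x <= 1 -> is_derive x 1 G (flat_bump 0 0 x).
  move=> /andP[x0 x1].
  have [|||dx Gx] := @continuous_FTC1_closed R (flat_bump 0 0) (-1) x 2 _ (ib _ _).
  - by rewrite (le_lt_trans x1)// ltrDl.
  - by rewrite (lt_le_trans _ x0)// ltrN10.
  - exact: cb.
  by apply: DeriveDef; [exact: dx|rewrite -derive1E].
have GE : G 1 - G 0 = bump_mass.
  rewrite /G Rintegral_itvB ?bnd_simp ?lerN10//=.
  have i01 : lebesgue_measure.-integrable `](0 : R), 1[ (EFin \o flat_bump 0 0).
    by apply: integrableS (ib 0 1) => //; exact: subset_itv_oo_cc.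
  rewrite -Rintegral_itv_bndo_bndc//; apply: eq_Rintegral => x.
  by rewrite inE /= in_itv /= => xI; rewrite flat_bump00E.
have [L L0 bL] := lipschitzR_osc (0 : R) 0 0 0.
have {}bL x y : `|flat_bump 0 0 x - flat_bump 0 0 y| <= L * `|x - y|.
  by have := bL x y; rewrite /osc !mul0r !add0r cos0 !mulr1.
split.
  apply/cvgrPdist_le => e e0; near=> n.
  have n0 : (0 < n)%N by near: n; exact: nbhs_infty_gt.
  rewrite distrC -GE; apply: le_trans (rsum_derive dG bL n0) _.
  rewrite ler_pdivrMr ?ltr0n// -ler_pdivrMl//.
  by near: n; apply: nbhs_infty_ger.
rewrite -GE.
have [|x xI||c + ->] := @MVT R G (flat_bump 0 0) 0 1.
- exact: ltr01.
- apply: dG; move: xI; rewrite in_itv /= => /andP[? ?]; apply/andP; split; exact: ltW.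
- apply: derivable_within_continuous => x; rewrite in_itv /= => xI.
  by have [] := dG _ xI.
by rewrite in_itv /= subr0 mulr1 => cI; rewrite flat_bump00E// expR_gt0.
Unshelve. all: by end_near. Qed.

End Decay.

(** * The real-valued norm of a complex Banach space *)

Section RealNorm.
Context (R : realType) (B : completeNormedModType R[i]).
Implicit Types (u v b : B).

(** The norm of B takes values in R[i], where the order is only partial; estimates
    are carried out on its real part. *)
Definition nrm b : R := complex.Re `|b|.

Lemma normr_nrm b : `|b| = (nrm b)%:C.
Proof.
rewrite /nrm; have : 0 <= `|b| by [].
by case: (`|b|) => x y; rewrite lecE /= => /andP[/eqP -> _].
Qed.

Lemma nrm_ge0 b : 0 <= nrm b.
Proof. by rewrite -lecR -normr_nrm rmorph0. Qed.

Lemma nrm0 : nrm 0 = 0. Proof. by rewrite /nrm normr0. Qed.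

Lemma nrm_eq0 b : nrm b = 0 -> b = 0.
Proof. by move=> b0; apply/eqP; rewrite -normr_eq0 normr_nrm b0. Qed.

Lemma nrmD u v : nrm (u + v) <= nrm u + nrm v.
Proof. by rewrite -lecR rmorphD /= -!normr_nrm ler_normD. Qed.

Lemma nrmN b : nrm (- b) = nrm b.
Proof. by rewrite /nrm normrN. Qed.

Lemma nrm_distC u v : nrm (u - v) = nrm (v - u).
Proof. by rewrite -nrmN opprB. Qed.

Lemma nrm_dist_triangle w u v : nrm (u - v) <= nrm (u - w) + nrm (w - v).
Proof. by rewrite -(subrKA w) nrmD. Qed.

Lemma nrm_dist_dist u v : `|nrm u - nrm v| <= nrm (u - v).
Proof.
have h w z : nrm w - nrm z <= nrm (w - z).
  by rewrite lerBlDr -{1}(subrK z w) nrmD.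
by rewrite ler_norml h andbT lerNl opprB nrm_distC h.
Qed.

Lemma nrm_sum I (r : seq I) (P : pred I) (F : I -> B) :
  nrm (\sum_(i <- r | P i) F i) <= \sum_(i <- r | P i) nrm (F i).
Proof.
elim/big_ind2 : _ => //; first by rewrite nrm0.
by move=> x1 x2 y1 y2 h1 h2; rewrite (le_trans (nrmD _ _))// lerD.
Qed.

Lemma nrmZ (c : R) b : nrm (c%:C *: b) = `|c| * nrm b.
Proof.
apply: (@complexI R); rewrite rmorphM /= -!normr_nrm normrZ.
by rewrite normc_def /= expr0n addr0 sqrtr_sqr.
Qed.

(** Not sharp, but it lets the cosine and sine parts of a mode be estimated
    separately. *)
Lemma nrmZ_le (c : R[i]) b :
  nrm (c *: b) <= (`|complex.Re c| + `|complex.Im c|) * nrm b.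
Proof.
rewrite {1}[c]complexE scalerDl (le_trans (nrmD _ _))// mulrDl lerD//.
  by rewrite nrmZ.
rewrite -scalerA -nrmZ le_eqVlt; apply/orP; left; apply/eqP/complexI.
rewrite -!normr_nrm normrZ normc_def /= expr0n expr1n add0r sqrtr1.
by rewrite mul1r.
Qed.

Lemma cvg_nrm (I : Type) (F : set_system I) {FF : Filter F} (u : I -> B) v :
  (u @ F --> v) <-> (nrm (u i - v) @[i --> F] --> (0 : R)).
Proof.
split=> [uv|uv].
  apply/cvgrPdist_le => e e0.
  have e0' : 0 < e%:C by rewrite ltcR.
  move/cvgrPdist_le : uv => /(_ _ e0'); apply: filterS => i.
  by rewrite sub0r normrN ger0_norm ?nrm_ge0// nrm_distC normr_nrm lecR.
apply/cvgrPdist_le => -[e e'] /[!ltcE]/= /andP[/eqP-> e0].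
move/cvgrPdist_le : uv => /(_ _ e0); apply: filterS => i.
by rewrite sub0r normrN ger0_norm ?nrm_ge0// nrm_distC normr_nrm lecR.
Qed.

Lemma nrm_cauchy_cvg (u : nat -> B) :
  (forall e, 0 < e -> exists N, forall n m, (N <= n)%N -> (N <= m)%N ->
     nrm (u n - u m) <= e) -> cvg (u @ \oo).
Proof.
move=> uC; apply: cauchy_cvg; apply: cauchy_exP => -[e e'] /[!ltcE]/= /andP[/eqP-> e0].
have [|N uN] := uC (e / 2); first by rewrite divr_gt0.
exists (u N); exists N => //= n Nn.
rewrite -ball_normE /= normr_nrm ltcR (le_lt_trans (uN _ _ _ Nn))//.
by rewrite ltr_pdivrMr// ltr_pMr// ltr1n.
Qed.

End RealNorm.

(** * Bochner integrals of simple functions *)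

Section Simple.
Context d (T : measurableType d) (R : realType) (B : completeNormedModType R[i]).
Context (mu : {measure set T -> \bar R}) (D : set T).
Hypotheses (mD : measurable D) (muD : (mu D < +oo)%E).

Section Finite_label.
Context (I : finType) (p : T -> I).
Hypothesis mp : forall i, measurable (p @^-1` [set i]).

(** A simple function is treated as c \o p, with p a measurable label in a finite
    type and c the value attached to each label.  Values may repeat, so two simple
    functions can always be given a common label. *)
Definition label_mass (i : I) : R := fine (mu (D `&` p @^-1` [set i])).

Lemma measurable_fiber i : measurable (D `&` p @^-1` [set i]).
Proof. exact: measurableI. Qed.

Lemma fin_num_fiber (A : set T) : measurable A -> mu (D `&` A) \is a fin_num.
Proof.
move=> mA; rewrite ge0_fin_numE//; apply: le_lt_trans muD.
by rewrite le_measure ?inE//; exact: measurableI.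
Qed.

Lemma label_mass_ge0 i : 0 <= label_mass i.
Proof. exact: fine_ge0. Qed.

Lemma measurable_preimage_label U (c : I -> U) (A : set U) :
  measurable ((c \o p) @^-1` A).
Proof.
rewrite [X in measurable X](_ : _ = \big[setU/set0]_(i <- enum I | `[< A (c i) >]) (p @^-1` [set i])).
  by apply: bigsetU_measurable => i _.
rewrite -bigcup_seq_cond; apply/seteqP; split=> x /=.
  by move=> Ax; exists (p x) => //=; rewrite mem_enum /=; exact/asboolP.
by move=> [i /= /andP[_ /asboolP Ai] ->].
Qed.

Lemma integral_label (h : I -> R) : (forall i, 0 <= h i) ->
  (\int[mu]_(x in D) (h (p x))%:E = (\sum_i label_mass i * h i)%:E)%E.
Proof.
move=> h0.
have DE : D = \big[setU/set0]_(i <- enum I) (D `&` p @^-1` [set i]).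
  rewrite -bigcup_seq -setI_bigcupr [X in _ = _ `&` X](_ : _ = setT) ?setIT//.
  by rewrite -subTset => x _; exists (p x) => //=; rewrite mem_enum.
rewrite [X in integral _ X _]DE ge0_integral_bigsetU//=.
- rewrite -sumEFin big_enum /=; apply: eq_bigr => i _.
  rewrite (eq_integral (cst (h i)%:E)); last first.
    by move=> x; rewrite inE /= => -[_ ->].
  rewrite integral_cst; last exact: measurable_fiber.
  by rewrite mulrC EFinM fineK// fin_num_fiber.
- by move=> i; exact: measurable_fiber.
- exact: enum_uniq.
- by move=> i j _ _ [x [[_ <-] [_ <-]]].
- move=> _ A mA; rewrite -DE; apply: measurableI => //; exact: (measurable_preimage_label (EFin \o h)).
- by move=> x _; rewrite lee_fin.
Qed.

Lemma bochner_simple_label (c : I -> B) : bochner_simple mu D (c \o p).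
Proof.
split=> [|b|b _]; last 2 first.
- exact: measurable_preimage_label.
- by rewrite ltey_eq fin_num_fiber//; exact: measurable_preimage_label.
apply: (@sub_finite_set _ _ [set` codom c]); last exact: finite_seq.
by move=> _ [x _ <-]; exact: codom_f.
Qed.

(** The definition groups the points of D by value; here they are grouped by
    label, and the labels sharing a value are collected. *)
Lemma bochner_simple_integral_label (c : I -> B) :
  bochner_simple_integral mu D (c \o p) = \sum_i (label_mass i)%:C *: c i.
Proof.
rewrite /bochner_simple_integral (@fsbig_fwiden _ _ _ _ (undup (codom c))).
- under eq_bigr => b _.
    (* the mass of a value is obtained by integrating its indicator *)
    rewrite (_ : fine _ = \sum_(i | c i == b) label_mass i); last first.
      rewrite setIC -integral_indic//; last exact: (measurable_preimage_label c).
      have -> : (\int[mu]_(x in D) (\1_((c \o p) @^-1` [set b]) x)%:E =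
          \int[mu]_(x in D) (((c (p x)) == b)%:R)%:E)%E.
        apply: eq_integral => x _; rewrite indicE; congr ((nat_of_bool _)%:R%:E).
        by apply/idP/eqP => [/set_mem//|cb]; apply/mem_set.
      rewrite (integral_label (h := fun i => (c i == b)%:R))//=.
      rewrite [RHS]big_mkcond; apply: eq_bigr => i _.
      by case: ifP; rewrite ?mulr1 ?mulr0.
    rewrite rmorph_sum /= scaler_suml.
    rewrite (eq_bigr (fun i => (label_mass i)%:C *: c i)); last first.
      by move=> i /eqP ->.
    over.
  rewrite (exchange_big_dep xpredT)//=; apply: eq_bigr => i _.
  rewrite -big_filter (eq_filter (a2 := pred1 (c i))); last first.
    by move=> b /=; rewrite eq_sym.
  by rewrite filter_pred1_uniq ?undup_uniq ?mem_undup ?codom_f// big_seq1.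
- by move=> _ [x _ <-] /=; rewrite mem_undup codom_f.
- exact: undup_uniq.
- move=> b /= [_ nb].
  rewrite [X in D `&` X](_ : _ = set0) ?setI0 ?measure0 ?scale0r//.
  by apply/seteqP; split=> x //= cb; apply: nb; exists x.
Qed.

End Finite_label.

Lemma bochner_simple_labelP (s : T -> B) : bochner_simple mu D s ->
  exists (I : finType) (p : T -> I) (c : I -> B),
    (forall i, measurable (p @^-1` [set i])) /\ s = c \o p.
Proof.
move=> [fs ms _].
have ps x : s x \in fset_set (range s) by rewrite in_fset_set// inE; exists x.
exists (fset_set (range s)), (fun x => [` ps x]%fset), val; split=> // i.
rewrite [X in measurable X](_ : _ = s @^-1` [set val i])//.
apply/seteqP; split=> x /=; first by move=> <-.
by move=> sx; exact: val_inj.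
Qed.

(** With the pair of labels as a common label this is the triangle inequality for
    a finite sum. *)
Lemma bochner_simple_integral_dist (s s' : T -> B) :
  bochner_simple mu D s -> bochner_simple mu D s' ->
  ((nrm (bochner_simple_integral mu D s - bochner_simple_integral mu D s'))%:E
    <= \int[mu]_(x in D) (nrm (s x - s' x))%:E)%E.
Proof.
move=> /bochner_simple_labelP[I [p [c [mp ->]]]] /bochner_simple_labelP[I' [p' [c' [mp' ->]]]].
pose q x := (p x, p' x).
have mq i : measurable (q @^-1` [set i]).
  rewrite [X in measurable X](_ : _ = (p @^-1` [set i.1]) `&` (p' @^-1` [set i.2])).
    exact: measurableI.
  apply/seteqP; split=> x /=; rewrite /q; case: i => i j /=; first by case.
  by move=> [-> ->].
have -> : c \o p = (c \o fst) \o q by [].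
have -> : c' \o p' = (c' \o snd) \o q by [].
rewrite !bochner_simple_integral_label// -sumrB.
rewrite (integral_label mq (h := fun i => nrm (c i.1 - c' i.2)))//; last by move=> i; exact: nrm_ge0.
rewrite lee_fin (le_trans (nrm_sum _ _ _))//; apply: ler_sum => i _.
by rewrite -scalerBr nrmZ ger0_norm// label_mass_ge0.
Qed.

(** The weak form of measurability under which the distances from g to simple
    functions are measurable, so that their integrals add up; it is clear for
    continuous functions even when B is not separable. *)
Definition nrm_measurable (g : T -> B) :=
  forall b, measurable_fun D (fun x => nrm (g x - b)).

Lemma nrm_measurable_simple s : bochner_simple mu D s -> nrm_measurable s.
Proof.
move=> /bochner_simple_labelP[I [p [c [mp ->]]]] b _ A mA.
apply: measurableI => //.
exact: (measurable_preimage_label mp (fun i => nrm (c i - b))).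
Qed.

Lemma measurable_nrm_dist g s : nrm_measurable g -> bochner_simple mu D s ->
  measurable_fun D (fun x => nrm (g x - s x)).
Proof.
move=> mg /bochner_simple_labelP[I [p [c [mp ->]]]].
rewrite (_ : (fun _ => _) = fun x =>
    \sum_(i <- enum I) (nrm (g x - c i) * \1_(p @^-1` [set i]) x)); last first.
  apply/funext => x; rewrite big_enum /= (bigD1 (p x))//= big1 ?addr0.
    by rewrite indicE mem_set// mulr1.
  move=> i ip; rewrite indicE memNset ?mulr0//= => pi.
  by rewrite pi eqxx in ip.
apply: measurable_sum => i; apply: measurable_funM; first exact: mg.
exact: measurable_indic.
Qed.

Lemma integral_nrm_dist_le g s e : nrm_measurable g -> bochner_simple mu D s ->
  0 <= e -> (forall x, D x -> nrm (g x - s x) <= e) ->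
  (\int[mu]_(x in D) (nrm (g x - s x))%:E <= e%:E * mu D)%E.
Proof.
move=> mg ss e0 gse; rewrite -integral_cst//; apply: ge0_le_integral => //.
- by move=> x _; rewrite lee_fin nrm_ge0.
- by apply/measurable_EFinP; exact: measurable_nrm_dist.
Qed.

(** Both the uniqueness of the integral and the Cauchy property of the integrals of
    approximating simple functions follow from this bound. *)
Lemma bochner_simple_integral_dist_via g s s' : nrm_measurable g ->
  bochner_simple mu D s -> bochner_simple mu D s' ->
  ((nrm (bochner_simple_integral mu D s - bochner_simple_integral mu D s'))%:E <=
    \int[mu]_(x in D) (nrm (g x - s x))%:E +
    \int[mu]_(x in D) (nrm (g x - s' x))%:E)%E.
Proof.
move=> mg ss ss'; apply: le_trans (bochner_simple_integral_dist ss ss') _.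
have mEg t : bochner_simple mu D t ->
    measurable_fun D (fun x => (nrm (g x - t x))%:E).
  by move=> st; apply/measurable_EFinP; exact: measurable_nrm_dist.
rewrite -ge0_integralD//; [|by move=> x _; rewrite lee_fin nrm_ge0|exact: mEg
  |by move=> x _; rewrite lee_fin nrm_ge0|exact: mEg].
apply: ge0_le_integral => //.
- by move=> x _; rewrite lee_fin nrm_ge0.
- apply/measurable_EFinP; apply: measurable_nrm_dist => //.
  exact: nrm_measurable_simple.
- by apply: emeasurable_funD; exact: mEg.
- move=> x _; rewrite -EFinD lee_fin (nrm_distC (g x)).
  exact: nrm_dist_triangle.
Qed.

Lemma is_bochner_integral_unique g v v' : nrm_measurable g ->
  is_bochner_integral mu D g v -> is_bochner_integral mu D g v' -> v = v'.
Proof.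
move=> mg [s [ss _ sg sv]] [s' [ss' _ sg' sv']].
apply/eqP; rewrite -subr_eq0; apply/eqP/nrm_eq0/eqP.
rewrite eq_le nrm_ge0 andbT; apply/ler_addgt0Pr => e e0; rewrite add0r.
move/cvg_nrm : sv => /cvgr0_norm_le /(_ (e / 4)) sv.
move/cvg_nrm : sv' => /cvgr0_norm_le /(_ (e / 4)) sv'.
have e4 : 0 < e / 4 by rewrite divr_gt0.
have small u : (u n @[n --> \oo] --> 0)%E -> (forall n, 0 <= u n)%E ->
    \forall n \near \oo, (u n <= (e / 4)%:E)%E.
  move=> u0 un; have /fine_cvgP[ufin /cvgr0_norm_le /(_ _ e4)] := u0.
  apply: filterS2 ufin => n fu.
  by rewrite -lee_fin /= ger0_norm ?fine_ge0// fineK.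
have ge0I (t : nat -> T -> B) n : (0 <= \int[mu]_(x in D) (nrm (g x - t n x))%:E)%E.
  by apply: integral_ge0 => x _; rewrite lee_fin nrm_ge0.
near \oo => n.
have h1 : nrm (bochner_simple_integral mu D (s n) - v) <= e / 4.
  by rewrite -[leLHS]ger0_norm ?nrm_ge0//; near: n; exact: sv.
have h2 : nrm (bochner_simple_integral mu D (s' n) - v') <= e / 4.
  by rewrite -[leLHS]ger0_norm ?nrm_ge0//; near: n; exact: sv'.
have h3 : nrm (bochner_simple_integral mu D (s n) -
               bochner_simple_integral mu D (s' n)) <= e / 4 + e / 4.
  rewrite -lee_fin; apply: le_trans (bochner_simple_integral_dist_via mg (ss n) (ss' n)) _.
  by rewrite EFinD; apply: leeD; near: n; apply: small.
rewrite (le_trans (nrm_dist_triangle (bochner_simple_integral mu D (s n)) _ _))//.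
rewrite [leRHS](_ : e = e / 4 + ((e / 4 + e / 4) + e / 4)); last by field.
rewrite lerD ?(nrm_distC v)//.
by rewrite (le_trans (nrm_dist_triangle (bochner_simple_integral mu D (s' n)) _ _))// lerD.
Unshelve. all: by end_near. Qed.

End Simple.

(** * Bochner integrals as limits of Riemann sums *)

Section Riemann.
Context (R : realType) (B : completeNormedModType R[i]).

Definition unif_cont (h : R -> B) := forall e, 0 < e ->
  exists2 d, 0 < d & forall x y, `|x - y| <= d -> nrm (h x - h y) <= e.

(** The counterpart of rsum for functions with values in B. *)
Definition brsum (n : nat) (h : R -> B) : B :=
  (n%:R^-1)%:C *: \sum_(j < n) h (j%:R / n%:R).

Section Fixed_length.
Context (T : R) (T0 : 0 < T).

Local Notation mu := (@lebesgue_measure R).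
Local Notation D := `[0, T]%classic.

Lemma unif_cont_nrm_measurable h : unif_cont h ->
  nrm_measurable D (fun t => h (t / T)).
Proof.
move=> uh b; apply: measurable_funTS; apply: continuous_measurable_fun => x.
apply/cvgrPdist_le => e e0.
have [d d0 hd] := uh _ e0.
have dT : 0 < d * T by rewrite mulr_gt0.
have /cvgrPdist_le/(_ _ dT) : y @[y --> x] --> x by exact: cvg_id.
apply: filterS => y xy; rewrite (le_trans (nrm_dist_dist _ _))//.
rewrite opprB addrA subrK; apply: hd.
by rewrite -mulrBl normrM normfV (gtr0_norm T0) ler_pdivrMr.
Qed.

(** The index of the cell of the grid of mesh T/n containing t.  Points outside
    [0, T] go to the nearest index, and t = T gets the extra index n; its cell
    within [0, T] is a single point, hence of mass 0. *)
Definition node (n : nat) (t : R) : 'I_n.+1 :=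
  inord (minn (Num.truncn (n%:R * (t / T))) n).

Lemma nodeE n t : node n t = minn (Num.truncn (n%:R * (t / T))) n :> nat.
Proof. by rewrite inordK// ltnS geq_minr. Qed.

Lemma leq_node n t j : (0 < j <= n)%N ->
  (j <= node n t)%N = (j%:R * T / n%:R <= t).
Proof.
case: j => // j /andP[_ jn].
have n0 : 0 < n%:R :> R by rewrite ltr0n (leq_trans _ jn).
rewrite nodeE leq_min jn andbT truncn_gt_nat ler_pdivrMr// mulrA ler_pdivlMr//.
by rewrite (mulrC t).
Qed.

Lemma measurable_node n i : measurable (node n @^-1` [set i]).
Proof.
have mle j : measurable [set t | (j <= node n t)%N].
  have [->|j0] := posnP j; first by rewrite (_ : [set _ | _] = setT)//; apply/seteqP.
  have [jn|jn] := leqP j n; last first.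
    rewrite (_ : [set _ | _] = set0)//; apply/seteqP; split=> t //=.
    by rewrite leqNgt (leq_trans (ltn_ord _) jn).
  rewrite (_ : [set _ | _] = `[j%:R * T / n%:R, +oo[%classic); first exact: measurable_itv.
  by apply/seteqP; split=> t /=; rewrite in_itv/= andbT leq_node ?j0 ?jn.
rewrite [X in measurable X](_ : _ = [set t | (i <= node n t)%N] `\` [set t | (i < node n t)%N]).
  exact: measurableD.
apply/seteqP; split=> t /=; first by move=> ->; rewrite ltnn.
by move=> [it /negP]; rewrite -leqNgt => ti; apply/val_inj/anti_leq; rewrite ti.
Qed.

Lemma node_truncn n t : (0 < n)%N -> D t ->
  node n t = Num.truncn (n%:R * (t / T)) :> nat.
Proof.
move=> n0; rewrite /= in_itv /= => /andP[t0 tT].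
have x0 : 0 <= n%:R * (t / T) by rewrite mulr_ge0// divr_ge0// ltW.
rewrite nodeE; apply/minn_idPl; rewrite -ltnS truncn_lt_nat//.
rewrite (@le_lt_trans _ _ n%:R)// ?ltr_nat// ler_piMr//.
by rewrite ler_pdivrMr// mul1r.
Qed.

Lemma label_mass_node n i : (0 < n)%N ->
  label_mass mu D (node n) i = if (i < n)%N then T / n%:R else 0.
Proof.
move=> n0; have n0' : 0 < n%:R :> R by rewrite ltr0n.
have fiberE : D `&` node n @^-1` [set i] =
    if (i < n)%N then `[i%:R * T / n%:R, i.+1%:R * T / n%:R[%classic
    else [set T].
  have iE t : D t -> (node n t == i) = (i%:R * T / n%:R <= t < i.+1%:R * T / n%:R).
    move=> Dt; rewrite -val_eqE /= node_truncn// truncn_eq; last first.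
      by move: Dt; rewrite /= in_itv /= => /andP[? _]; rewrite mulr_ge0// divr_ge0// ltW.
    by rewrite ler_pdivrMr// ltr_pdivlMr// mulrA ler_pdivlMr// ltr_pdivrMr// (mulrC t).
  have nT : n%:R * T / n%:R = T by rewrite mulrAC divff ?gt_eqF// mul1r.
  case: ifPn => [i_n|n_i]; apply/seteqP; split=> t.
  - by move=> [Dt /eqP]; rewrite iE//= in_itv.
  - rewrite /= in_itv /= => tI.
    have Dt : D t.
      case/andP: tI => t1 t2; rewrite /= in_itv /=; apply/andP; split.
        by rewrite (le_trans _ t1)// divr_ge0// mulr_ge0// ltW.
      by rewrite (le_trans (ltW t2))// ler_pdivrMr// mulrC ler_pM2l// ler_nat.
    by split; [move: Dt; rewrite /= in_itv|apply/eqP; rewrite iE].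
  - have iN : i = n :> nat by apply/eqP; rewrite eqn_leq -ltnS ltn_ord leqNgt n_i.
    move=> [Dt /eqP]; rewrite iE// iN nT => /andP[Tt _].
    by apply/eqP; rewrite eq_le Tt andbT; move: Dt; rewrite /= in_itv => /andP[].
  - have iN : i = n :> nat by apply/eqP; rewrite eqn_leq -ltnS ltn_ord leqNgt n_i.
    move=> ->; have DT : D T by rewrite /= in_itv /= lexx ltW.
    split=> //; apply/eqP; rewrite iE// iN nT lexx /=.
    by rewrite ltr_pdivlMr// mulrC ltr_pM2r// ltr_nat.
rewrite /label_mass fiberE; case: ifP => _; last by rewrite [X in fine X](lebesgue_measure_set1 T).
rewrite [X in fine X]lebesgue_measure_itv /= lte_fin.
rewrite -!mulrA ltr_pM2r ?divr_gt0// ltr_nat ltnSn -EFinB /= -mulrBl.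
by rewrite -natrB ?subSnn ?mul1r.
Qed.

Lemma node_dist n t : (0 < n)%N -> D t ->
  `|t / T - (node n t)%:R / n%:R| <= n%:R^-1.
Proof.
move=> n0; rewrite /= in_itv /= => /andP[t0 tT].
have n0' : 0 < n%:R :> R by rewrite ltr0n.
have x0 : 0 <= n%:R * (t / T) by rewrite mulr_ge0// divr_ge0// ltW.
have /andP[h1 h2] := truncn_itv x0.
rewrite node_truncn//; last by rewrite /= in_itv /= t0.
set k := Num.truncn _ in h1 h2 *.
have -> : t / T - k%:R / n%:R = (n%:R * (t / T) - k%:R) / n%:R.
  by rewrite mulrBl mulrAC divff ?gt_eqF// mul1r.
rewrite normrM normfV (gtr0_norm n0') ler_pdivrMr// mulVf ?gt_eqF//.
by rewrite ger0_norm ?subr_ge0// lerBlDr -(natrD _ 1) add1n ltW.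
Qed.

Lemma bochner_simple_integral_node n h : (0 < n)%N ->
  bochner_simple_integral mu D (fun t => h ((node n t)%:R / n%:R)) =
  T%:C *: brsum n h.
Proof.
move=> n0.
have muD : (mu D < +oo)%E by rewrite lebesgue_measure_itv /= lte_fin T0 ltry.
have := bochner_simple_integral_label (mu := mu) (D := D) (measurable_itv _) muD
  (@measurable_node n) (fun i : 'I_n.+1 => h (i%:R / n%:R)).
rewrite /comp /= => ->.
rewrite big_ord_recr /= label_mass_node// ltnn scale0r addr0.
rewrite /brsum scalerA scaler_sumr; apply: eq_bigr => i _.
by rewrite label_mass_node//= ltn_ord -rmorphM.
Qed.

(** The step functions on the grid are within the modulus of continuity of h on the
    interval, so their integrals form a Cauchy sequence; these integrals are T
    times the Riemann sums. *)
Lemma is_bochner_integral_unif_cont h : unif_cont h ->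
  exists v, [/\ is_bochner_integral mu D (fun t => h (t / T)) (T%:C *: v) &
                brsum n h @[n --> \oo] --> v].
Proof.
move=> uh; pose g t := h (t / T).
have muDE : mu D = T%:E by rewrite lebesgue_measure_itv /= lte_fin T0 oppr0 adde0.
have muD : (mu D < +oo)%E by rewrite muDE ltry.
have mD : measurable D by exact: measurable_itv.
have mg : nrm_measurable D g by exact: unif_cont_nrm_measurable.
pose s (n : nat) t := h ((node n.+1 t)%:R / n.+1%:R).
have ss n : bochner_simple mu D (s n).
  have := bochner_simple_label (mu := mu) mD muD (@measurable_node n.+1)
    (fun i : 'I_n.+2 => h (i%:R / n.+1%:R)).
  by rewrite /comp.
have bs n : bochner_simple_integral mu D (s n) = T%:C *: brsum n.+1 h.
  exact: bochner_simple_integral_node.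
have sg e : 0 < e -> exists N, forall n t, (N <= n)%N -> D t -> nrm (g t - s n t) <= e.
  move=> /uh[d d0 hd]; exists (Num.truncn d^-1) => n t Nn Dt.
  apply: hd; apply: (le_trans (node_dist _ Dt)) => //.
  rewrite invf_ple ?posrE// ?ltr0n//.
  apply: (@le_trans _ _ (Num.truncn d^-1).+1%:R); last by rewrite ler_nat.
  by apply: ltW; apply: real_truncnS_gt; exact: num_real.
have isg e : 0 < e -> exists N, forall n, (N <= n)%N ->
    (\int[mu]_(x in D) (nrm (g x - s n x))%:E <= (e * T)%:E)%E.
  move=> e0; have [N gN] := sg _ e0; exists N => n Nn.
  rewrite EFinM -muDE; apply: integral_nrm_dist_le => //; first exact: ltW.
  by move=> x; exact: gN.
have /cvg_ex[v sv] : cvg (brsum n.+1 h @[n --> \oo]).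
  apply: nrm_cauchy_cvg => e e0.
  have [|N HN] := isg (e / 2); first by rewrite divr_gt0.
  exists N => n m Nn Nm; rewrite -(ler_pM2l T0) -[X in X * nrm _]gtr0_norm//.
  rewrite -nrmZ scalerBr -!bs -lee_fin.
  have H := (bochner_simple_integral_dist_via (mu := mu) mD muD mg (ss n) (ss m)).
  apply: (le_trans H).
  rewrite mulrC [in leRHS](splitr e) mulrDl EFinD.
  by apply: leeD; exact: HN.
exists v; split; last by rewrite -cvg_shiftS.
exists s; split => //.
- apply: aeW => t Dt; apply/cvg_nrm/cvgrPdist_le => e e0.
  have [N gN] := sg _ e0; exists N => // n /= Nn.
  by rewrite sub0r normrN ger0_norm ?nrm_ge0// nrm_distC gN.
- have I0 n : (0 <= \int[mu]_(x in D) (nrm (g x - s n x))%:E)%E.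
    by apply: integral_ge0 => x _; rewrite lee_fin nrm_ge0.
  have fI e n : (\int[mu]_(x in D) (nrm (g x - s n x))%:E <= e%:E)%E ->
      (\int[mu]_(x in D) (nrm (g x - s n x))%:E)%E \is a fin_num.
    by move=> h'; rewrite ge0_fin_numE// (le_lt_trans h')// ltry.
  apply/fine_cvgP; split.
    have [N HN] := isg _ ltr01; exists N => // n /= Nn; exact: (fI _ _ (HN _ Nn)).
  apply/cvgrPdist_le => e e0.
  have [|N HN] := isg (e / T); first by rewrite divr_gt0.
  exists N => // n /= Nn; rewrite sub0r normrN ger0_norm; last exact: fine_ge0 (I0 n).
  have := HN _ Nn; rewrite divfK ?gt_eqF// => In.
  by rewrite -lee_fin fineK// (fI _ _ In).
- have -> : (fun n => bochner_simple_integral mu D (s n)) =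
      (fun n => T%:C *: brsum n.+1 h) by apply/funext.
  apply/cvg_nrm; move/cvg_nrm : sv => sv.
  under eq_fun => n do rewrite -scalerBr nrmZ.
  suff : `|T| * nrm (brsum n.+1 h - v) @[n --> \oo] --> `|T| * 0 by rewrite mulr0.
  exact: cvgMr.
Qed.

End Fixed_length.
End Riemann.

(** * Uniformly continuous functions and vector Riemann sums *)

Section UnifCont.
Context (R : realType) (B : completeNormedModType R[i]).
Implicit Types (f g h : R -> B) (b : B).

Lemma unif_cont_lipschitz h L : 0 <= L ->
  (forall x y, nrm (h x - h y) <= L * `|x - y|) -> unif_cont h.
Proof.
move=> L0 hL e e0; exists (e / (L + 1)); first by rewrite divr_gt0// ltr_wpDl.
move=> x y xy; apply: (le_trans (hL x y)).
apply: (@le_trans _ _ ((L + 1) * `|x - y|)); first by rewrite ler_wpM2r// lerDl.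
by rewrite mulrC -ler_pdivlMr// ltr_wpDl.
Qed.

Lemma unif_contD g h : unif_cont g -> unif_cont h ->
  unif_cont (fun x => g x + h x).
Proof.
move=> ug uh e e0; have e2 : 0 < e / 2 by rewrite divr_gt0.
have [d d0 gd] := ug _ e2; have [d' d0' hd] := uh _ e2.
exists (Num.min d d'); first by rewrite lt_min d0.
move=> x y; rewrite le_min => /andP[xd xd'].
rewrite opprD addrACA (le_trans (nrmD _ _))// [leRHS]splitr.
by rewrite lerD ?gd ?hd.
Qed.

Lemma unif_cont_cst b : unif_cont (fun=> b).
Proof. by move=> e e0; exists 1 => // x y _; rewrite subrr nrm0 ltW. Qed.

Lemma unif_cont_sum N (h : nat -> R -> B) : (forall m, unif_cont (h m)) ->
  unif_cont (fun x => \sum_(m < N) h m x).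
Proof.
move=> uh; elim: N => [|N IH].
  by under eq_fun do rewrite big_ord0; exact: unif_cont_cst.
by under eq_fun do rewrite big_ord_recr /=; exact: unif_contD.
Qed.

(** Uniform limits of uniformly continuous functions; this transfers the property
    from trigonometric polynomials to f. *)
Lemma unif_cont_approx h :
  (forall e, 0 < e -> exists2 g, unif_cont g & forall x, nrm (h x - g x) <= e) ->
  unif_cont h.
Proof.
move=> happ e e0; have e3 : 0 < e / 3 by rewrite divr_gt0.
have [g ug hg] := happ _ e3; have [d d0 gd] := ug _ e3.
exists d => // x y /gd gxy.
rewrite (le_trans (nrm_dist_triangle (g x) _ _))//.
rewrite [leRHS](_ : e = e / 3 + (e / 3 + e / 3)); last by field.
rewrite lerD// (le_trans (nrm_dist_triangle (g y) _ _))// lerD//.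
by rewrite nrm_distC.
Qed.

Lemma unif_cont_affine h a p : unif_cont h -> unif_cont (fun x => h (a * x + p)).
Proof.
move=> uh e /uh[d d0 hd]; exists (d / (`|a| + 1)).
  by rewrite divr_gt0// ltr_wpDl.
move=> x y xy; apply: hd; rewrite opprD addrACA subrr addr0 -mulrBr normrM.
apply: (@le_trans _ _ ((`|a| + 1) * `|x - y|)); first by rewrite ler_wpM2r// lerDl.
by rewrite mulrC -ler_pdivlMr// ltr_wpDl.
Qed.

Lemma unif_contZ (w : R -> R) h W M : lipschitzR w ->
  (forall x, `|w x| <= W) -> (forall x, nrm (h x) <= M) -> unif_cont h ->
  unif_cont (fun x => (w x)%:C *: h x).
Proof.
move=> [L L0 wL] wW hM uh e e0.
have W0 : 0 <= W := le_trans (normr_ge0 _) (wW 0).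
have M0 : 0 <= M := le_trans (nrm_ge0 _) (hM 0).
have W1 : 0 < W + 1 by rewrite ltr_wpDl.
have K1 : 0 < L * M + 1 by rewrite ltr_wpDl// mulr_ge0.
have [|d d0 hd] := uh (e / 2 / (W + 1)); first by rewrite !divr_gt0.
exists (Num.min d (e / 2 / (L * M + 1))); first by rewrite lt_min d0 !divr_gt0.
move=> x y; rewrite le_min => /andP[/hd hxy xy].
have -> : (w x)%:C *: h x - (w y)%:C *: h y =
    (w x)%:C *: (h x - h y) + (w x - w y)%:C *: h y.
  by rewrite rmorphB /= scalerBr scalerBl addrA subrK.
rewrite (le_trans (nrmD _ _))// !nrmZ [leRHS]splitr lerD//.
  rewrite ler_pdivlMr// in hxy; rewrite (le_trans _ hxy)// mulrC ler_wpM2l ?nrm_ge0//.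
  by rewrite (le_trans (wW x))// lerDl.
rewrite ler_pdivlMr// in xy; rewrite (le_trans _ xy)//.
apply: (@le_trans _ _ (L * `|x - y| * M)); first by rewrite ler_pM ?nrm_ge0.
by rewrite mulrAC (mulrC `|_|) ler_wpM2r// lerDl.
Qed.

Lemma lipschitz_trig : lipschitzR (@cos R) /\ lipschitzR (@sin R).
Proof.
split.
  apply: (@lipschitzR_derive _ _ _ 1 (@is_derive_cos R)) => x.
  by rewrite normrN ler_norml sin_le1 sin_geN1.
apply: (@lipschitzR_derive _ _ _ 1 (@is_derive_sin R)) => x.
by rewrite ler_norml cos_le1 cos_geN1.
Qed.

Lemma unif_cont_expi b : unif_cont (fun x => expi x *: b).
Proof.
have [[L L0 cL] [M M0 sM]] := lipschitz_trig.
apply: (@unif_cont_lipschitz _ ((L + M) * nrm b)).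
  by rewrite mulr_ge0 ?nrm_ge0// addr_ge0.
move=> x y; rewrite -scalerBl (le_trans (nrmZ_le _ _))//.
by rewrite mulrAC ler_wpM2r ?nrm_ge0// mulrDl lerD ?cL ?sM.
Qed.

Lemma nrm_expiZ x b : nrm (expi x *: b) = nrm b.
Proof.
apply: (@complexI R); rewrite -!normr_nrm normrZ normc_def /=.
by rewrite cos2Dsin2 sqrtr1 mul1r.
Qed.

Lemma brsumD n g h : brsum n (fun x => g x + h x) = brsum n g + brsum n h.
Proof. by rewrite /brsum big_split scalerDr. Qed.

Lemma brsum_sum n N (h : nat -> R -> B) :
  brsum n (fun x => \sum_(m < N) h m x) = \sum_(m < N) brsum n (h m).
Proof. by rewrite /brsum exchange_big /= scaler_sumr. Qed.

Lemma brsum_dist_le n g h M : (0 < n)%N -> (forall x, nrm (g x - h x) <= M) ->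
  nrm (brsum n g - brsum n h) <= M.
Proof.
move=> n0 gh; rewrite -scalerBr -sumrB nrmZ normfV normr_nat.
rewrite ler_pdivrMl ?ltr0n// (le_trans (nrm_sum _ _ _))//.
apply: (@le_trans _ _ (\sum_(j < n) M)); first exact: ler_sum.
by rewrite sumr_const card_ord mulr_natl.
Qed.

(** Reduces the Riemann sums of a single Fourier mode to real scalar ones. *)
Lemma brsumZ n (u v : R -> R) b :
  brsum n (fun x => (u x +i* v x) *: b) = (rsum n u +i* rsum n v) *: b.
Proof.
rewrite /brsum -scaler_suml scalerA; congr (_ *: _).
rewrite (_ : \sum_(j < n) _ = (\sum_(j < n) u (j%:R / n%:R)) +i* (\sum_(j < n) v (j%:R / n%:R))).
  by rewrite /rsum /GRing.mul /= !mul0r subr0 addr0.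
elim/big_rec3 : _ => //= j x y z _ ->; by [].
Qed.

End UnifCont.

(** * Absolute convergence of the Fourier series *)

Section Fourier.
Context (R : realType) (B : completeNormedModType R[i]).
Context (Delta : R -> R) (f : R -> B).
Hypothesis hDelta : approximation_function Delta.
Hypothesis hf : in_B_Delta Delta f.
Hypothesis hsum : (\esum_(k in [set k : int | k != 0%R])
               ((Delta (`|k|%:~R))^-1)%:E < +oo)%E.

(** The k-th term of the Fourier series of f. *)
Definition mode (k : int) (x : R) : B :=
  expi (2 * pi * k%:~R * x) *: fourier_coef f k.

(** The symmetric partial sums add the modes m + 1 and - m - 1 together, which turns
    the two-sided series into one indexed by natural numbers. *)
Definition pair_mode (m : nat) (x : R) : B :=
  mode (m.+1%:Z) x + mode (- m.+1%:Z) x.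

Definition pair_norm (m : nat) : R :=
  nrm (fourier_coef f m.+1%:Z) + nrm (fourier_coef f (- m.+1%:Z)).

Lemma fourier_coef0 : fourier_coef f 0 = circle_integral f.
Proof.
congr circle_integral; apply/funext => x.
by rewrite mulr0 mul0r oppr0 /expi cos0 sin0 scale1r.
Qed.

Lemma fourier_partial_sumE n x :
  fourier_partial_sum f n x = circle_integral f + \sum_(m < n) pair_mode m x.
Proof.
have fpsE m : fourier_partial_sum f m x = \sum_(j < m.*2.+1) mode (j%:Z - m%:Z) x by [].
elim: n => [|n IH].
  rewrite fpsE big_ord_recl !big_ord0 subrr.
  by rewrite /mode mulr0 mul0r /expi cos0 sin0 scale1r fourier_coef0.
rewrite [in RHS]big_ord_recr [RHS]addrA -IH !fpsE.
rewrite doubleS big_ord_recl big_ord_recr [LHS]addrC -addrA /pair_mode.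
apply: f_equal2; last apply: f_equal2.
- apply: eq_bigr => j _; rewrite lift0 /=.
  by have -> : j.+1%:Z - n.+1%:Z = j%:Z - n%:Z by rewrite !intS opprD addrACA subrr add0r.
- rewrite lift0 /=.
  by have -> : n.*2.+2%:Z - n.+1%:Z = n.+1%:Z by rewrite -addnn !intS PoszD; ring.
- by rewrite /= sub0r.
Qed.

Lemma nrm_pair_mode m x : nrm (pair_mode m x) <= pair_norm m.
Proof.
have e k : nrm (mode k x) = nrm (fourier_coef f k) by exact: nrm_expiZ.
apply: (le_trans (nrmD (mode m.+1%:Z x) (mode (- m.+1%:Z) x))).
by apply: lerD; rewrite e.
Qed.

Lemma pair_norm_ge0 m : 0 <= pair_norm m.
Proof. by rewrite addr_ge0 ?nrm_ge0. Qed.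

Lemma Delta_gt0 m : 0 < Delta (m.+1%:Z%:~R).
Proof.
have [_ _ D1 _] := hDelta; apply: lt_le_trans ltr01 (D1 _ _).
by rewrite -pmulrn ler1n.
Qed.

Lemma pair_norm_le : exists2 M, 0 <= M &
  forall m, pair_norm m <= M * (Delta (m.+1%:Z%:~R))^-1.
Proof.
have [_ _ _] := hf.
set A := [set _ | _ in _] => Afin.
have [M0 hM0] : exists M0, forall x, A x -> (x <= M0%:E)%E.
  have [e0|] := eqVneq (ereal_sup A) -oo%E.
    by exists 0 => x /ereal_sup_ubound; rewrite e0 leeNy_eq => /eqP ->; rewrite leNye.
  move=> NNy; exists (fine (ereal_sup A)) => x /ereal_sup_ubound.
  by rewrite fineK// fin_numE NNy lt_eqF.
have hM k : k != 0 -> Delta (`|k|%:~R) * nrm (fourier_coef f k) <= M0.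
  by move=> k0; rewrite -lee_fin; apply: hM0; exists k.
exists (`|M0| + `|M0|); first by rewrite addr_ge0.
move=> m; rewrite mulrDl; apply: lerD; rewrite ler_pdivlMr ?Delta_gt0// mulrC.
  exact: le_trans (hM m.+1 isT) (ler_norm _).
have h := hM (- m.+1%:Z) isT; rewrite normrN in h.
exact: le_trans h (ler_norm _).
Qed.

(** The finite sums of 1 / Delta over 1, ..., n are among those whose supremum is
    the sum over all nonzero integers. *)
Lemma pair_norm_summable : exists2 S, 0 <= S & forall n, \sum_(m < n) pair_norm m <= S.
Proof.
have [M M0 hM] := pair_norm_le.
have [S hS] : exists S, forall n, \sum_(m < n) (Delta (m.+1%:Z%:~R))^-1 <= S.
  pose D (k : int) : R := (Delta (`|k|%:~R))^-1.
  pose E := (\esum_(k in [set k : int | k != 0%R]) (D k)%:E)%E.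
  have DS m : D m.+1%:Z = (Delta (m.+1%:Z%:~R))^-1 by rewrite /D ger0_norm.
  have D0 k : k != 0 -> 0 <= D k.
    rewrite -absz_gt0 /D invr_ge0 -abszE; case: `|k|%N => // m _.
    by rewrite ltW ?Delta_gt0.
  have E0 : (0 <= E)%E by apply: esum_ge0 => k k0; rewrite lee_fin D0.
  have Efin : E \is a fin_num by rewrite ge0_fin_numE.
  exists (fine E) => n; rewrite -lee_fin fineK// -sumEFin.
  apply: ereal_sup_ubound.
  pose s : seq int := [seq (m.+1)%:Z | m <- iota 0 n].
  have us : uniq s by rewrite map_inj_uniq ?iota_uniq// => i j [].
  exists [set` s].
    by split; [exact: finite_seq|move=> _ /= /mapP[m _ ->]].
  rewrite -fsbig_seq// big_map -(big_mkord xpredT (fun m => (D m.+1%:Z)%:E)).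
  by rewrite /index_iota subn0.
exists (M * S); first by have := hS 0%N; rewrite big_ord0 => S0; rewrite mulr_ge0.
move=> n; rewrite (le_trans (ler_sum _ (fun (m : 'I_n) _ => hM m)))//.
by rewrite -mulr_sumr ler_wpM2l// hS.
Qed.

(** The convergence is uniform in x, since the tail is dominated by the tail of a
    convergent series that does not depend on x. *)
Lemma fourier_tail e : 0 < e ->
  exists N, forall x, nrm (f x - fourier_partial_sum f N x) <= e.
Proof.
move=> e0; have [S _ hS] := pair_norm_summable.
pose u n : R := \sum_(m < n) pair_norm m.
have und : nondecreasing_seq u.
  by apply/nondecreasing_seqP => n; rewrite /u big_ord_recr /= lerDl pair_norm_ge0.
have ucvg : cvgn u.
  by apply: nondecreasing_is_cvgn => //; exists S => _ [n _ <-]; exact: hS.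
have uL n : u n <= limn u by exact: nondecreasing_cvgn_le.
have [N _ HN] : \forall n \near \oo, `|limn u - u n| <= e.
  by move/cvgrPdist_le : ucvg; apply.
exists N => x.
have Ne : limn u - u N <= e by apply: le_trans (HN N (leqnn N)); exact: ler_norm.
apply: le_trans Ne; apply/ler_addgt0Pr => e' e'0.
have [_ _ fx _] := hf.
move: (fx x) => /cvg_nrm /cvgr0_norm_le /(_ _ e'0) fxe.
near \oo => n.
have Nn : (N <= n)%N by near: n; exact: nbhs_infty_ge.
have h1 : nrm (fourier_partial_sum f n x - f x) <= e'.
  by rewrite -[leLHS]ger0_norm ?nrm_ge0//; near: n.
rewrite (le_trans (nrm_dist_triangle (fourier_partial_sum f n x) _ _))//.
rewrite nrm_distC addrC lerD//.
have h2 : nrm (fourier_partial_sum f n x - fourier_partial_sum f N x) <= u n - u N.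
  have split_sum (V : zmodType) (F : nat -> V) :
      \sum_(m < n) F m - \sum_(m < N) F m = \sum_(N <= m < n) F m.
    rewrite -!(big_mkord xpredT F) (big_cat_nat (n := N) (p := n))//=.
    by rewrite addrAC subrr add0r.
  rewrite !fourier_partial_sumE opprD addrACA subrr add0r /u.
  rewrite (split_sum _ (fun m => pair_mode m x)) (split_sum _ pair_norm).
  rewrite (le_trans (nrm_sum _ _ _))//; apply: ler_sum => m _.
  exact: nrm_pair_mode.
by rewrite (le_trans h2)// lerB.
Unshelve. all: by end_near. Qed.

Lemma unif_cont_mode k : unif_cont (mode k).
Proof.
have := unif_cont_affine (2 * pi * k%:~R) 0 (unif_cont_expi (fourier_coef f k)).
by congr unif_cont; apply/funext => x; rewrite /mode addr0.
Qed.

Lemma unif_cont_fourier_partial_sum N : unif_cont (fourier_partial_sum f N).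
Proof.
rewrite (funext (fourier_partial_sumE N)); apply: unif_contD; first exact: unif_cont_cst.
apply: unif_cont_sum => m; apply: unif_contD; exact: unif_cont_mode.
Qed.

Lemma unif_cont_fourier : unif_cont f.
Proof.
apply: unif_cont_approx => e /fourier_tail[N fN].
by exists (fourier_partial_sum f N) => //; exact: unif_cont_fourier_partial_sum.
Qed.

Lemma bounded_fourier : exists M, forall x, nrm (f x) <= M.
Proof.
have [S _ hS] := pair_norm_summable; have [N fN] := fourier_tail ltr01.
exists (1 + (nrm (circle_integral f) + S)) => x.
have fE : f x = (f x - fourier_partial_sum f N x) +
    (circle_integral f + \sum_(m < N) pair_mode m x).
  by rewrite -fourier_partial_sumE subrK.
rewrite fE; apply: le_trans (nrmD _ _) _; apply: lerD => //.
apply: le_trans (nrmD _ _) _; apply: lerD => //.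
apply: le_trans (nrm_sum _ _ _) _; apply: le_trans (hS N).
by apply: ler_sum => m _; exact: nrm_pair_mode.
Qed.

End Fourier.

(** * The weighted average *)

Section Average.
Context (R : realType) (B : completeNormedModType R[i]).
Context (Delta : R -> R) (f : R -> B).
Hypothesis hDelta : approximation_function Delta.
Hypothesis hf : in_B_Delta Delta f.
Hypothesis hsum : (\esum_(k in [set k : int | k != 0%R])
               ((Delta (`|k|%:~R))^-1)%:E < +oo)%E.

Let c : R := (bump_mass R)^-1.

Lemma bump_mass_gt0 : 0 < bump_mass R.
Proof. by have [] := rsum_bump_cvg R. Qed.

Lemma normr_wbar_le x : `|wbar x| <= c.
Proof.
have c0 : 0 < c by rewrite invr_gt0 bump_mass_gt0.
rewrite wbarE normrM gtr0_norm// -[leRHS]mulr1 ler_pM2l//.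
exact: normr_flat_bump_le.
Qed.

Lemma lipschitzR_wbar : lipschitzR (@wbar R).
Proof.
have := lipschitzRZ c (lipschitzR_osc (0 : R) 0 0 0).
congr lipschitzR; apply/funext => x.
by rewrite wbarE /osc mul0r addr0 cos0 mulr1.
Qed.

Lemma rsum_wbar_cvg : rsum n (@wbar R) @[n --> \oo] --> (1 : R).
Proof.
have [cv m0] := rsum_bump_cvg R.
have -> : (fun n => rsum n (@wbar R)) = (fun n => c * rsum n (flat_bump 0 0)).
  by apply/funext => n; rewrite -rsumZ; congr rsum; apply/funext => x; rewrite wbarE.
suff : c * rsum n (flat_bump 0 0) @[n --> \oo] --> c * bump_mass R.
  by rewrite mulVf// gt_eqF.
exact: cvgMr.
Qed.

Lemma unif_cont_average a theta :
  unif_cont (fun x => (wbar x)%:C *: f (a * x + theta)).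
Proof.
have [M fM] := bounded_fourier hDelta hf hsum.
apply: (unif_contZ lipschitzR_wbar normr_wbar_le (M := M)) => //.
by apply: unif_cont_affine; exact: unif_cont_fourier hDelta hf hsum.
Qed.

Lemma brsum_mode n a theta k :
  brsum n (fun x => (wbar x)%:C *: mode f k (a * x + theta)) =
  (c * rsum n (osc (2 * pi * k%:~R * a) 0 0 (2 * pi * k%:~R * theta)) +i*
   (c * rsum n (osc (2 * pi * k%:~R * a) 0 0 (2 * pi * k%:~R * theta - pi / 2))))
  *: fourier_coef f k.
Proof.
rewrite -!rsumZ -brsumZ; congr brsum; apply/funext => x.
rewrite /mode scalerA; congr (_ *: _).
rewrite /osc addrA -(mulrA _ a x) -mulrDr cosBpihalf !mulrA -!wbarE /expi.
by apply/eqP; rewrite eq_complex /= !mul0r subr0 addr0 !eqxx.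
Qed.

Lemma nrm_brsum_mode n a theta k K :
  (forall p, p = 2 * pi * k%:~R * theta \/ p = 2 * pi * k%:~R * theta - pi / 2 ->
    `|rsum n (osc (2 * pi * k%:~R * a) 0 0 p)| <= K) ->
  nrm (brsum n (fun x => (wbar x)%:C *: mode f k (a * x + theta))) <=
  2 * c * K * nrm (fourier_coef f k).
Proof.
move=> hK; have c0 : 0 < c by rewrite invr_gt0 bump_mass_gt0.
rewrite brsum_mode (le_trans (nrmZ_le _ _))// ler_wpM2r ?nrm_ge0//=.
rewrite (normrM c) (normrM c) (gtr0_norm c0).
have -> : 2 * c * K = c * K + c * K by ring.
by apply: lerD; rewrite ler_pM2l//; apply: hK; [left|right].
Qed.

(** Split f into a trigonometric polynomial and a uniformly small remainder.  The
    zero mode yields the integral of f since w has mass 1; the factor 2 in the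
    bound of each other mode comes from its real and imaginary parts. *)
Lemma average_bound a theta K v :
  (forall k p, k != 0 :> int ->
    limsup_le (fun n => `|rsum n (osc (2 * pi * k%:~R * a) 0 0 p)|) K) ->
  brsum n (fun x => (wbar x)%:C *: f (a * x + theta)) @[n --> \oo] --> v ->
  forall S, (forall n, \sum_(m < n) pair_norm f m <= S) ->
  nrm (v - circle_integral f) <= 2 * c * K * S.
Proof.
move=> hK hv S hS; set A := circle_integral f.
have c0 : 0 < c by rewrite invr_gt0 bump_mass_gt0.
have S0 : 0 <= S by have := hS 0%N; rewrite big_ord0.
(* C is the total number of times that the error e is made *)
pose C := 1 + (c + (nrm A + 2 * c * S)).
have C0 : 0 < C.
  by rewrite ltr_wpDr// !addr_ge0 ?nrm_ge0 ?mulr_ge0// ltW.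
apply/ler_addgt0Pr => d d0.
pose e := d / C; have e0 : 0 < e by rewrite divr_gt0.
have [N fN] := fourier_tail hDelta hf hsum e0.
pose w (x : R) := (wbar x)%:C.
pose h x := w x *: f (a * x + theta).
pose hN x := w x *: fourier_partial_sum f N (a * x + theta).
pose gm k x := w x *: mode f k (a * x + theta).
have hNE n : brsum n hN = (rsum n (@wbar R))%:C *: A +
    \sum_(m < N) (brsum n (gm m.+1%:Z) + brsum n (gm (- m.+1%:Z))).
  have -> : hN = fun x => (wbar x +i* 0) *: A +
      \sum_(m < N) (gm m.+1%:Z x + gm (- m.+1%:Z) x).
    apply/funext => x; rewrite /hN fourier_partial_sumE scalerDr scaler_sumr.
    by congr (_ + _); apply: eq_bigr => m _; rewrite -scalerDr.
  rewrite brsumD brsumZ (brsum_sum n N (fun m x => gm m.+1%:Z x + gm (- m.+1%:Z) x)); congr (_ + _).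
    congr (_ *: _); apply/eqP; rewrite eq_complex /= eqxx /=.
    by rewrite /rsum big1 ?mulr0.
  by apply: eq_bigr => m _; rewrite brsumD.
have K0 : 0 <= K + e.
  have [i _ Hi] := hK 1 0 isT _ e0.
  by apply: le_trans (Hi i (leqnn i)).
pose small k n := nrm (brsum n (gm k)) <= 2 * c * (K + e) * nrm (fourier_coef f k).
have osc_near k : k != 0 -> \forall n \near \oo, small k n.
  move=> k0; pose p := 2 * pi * k%:~R * theta : R.
  apply: filterS2 (hK k p k0 _ e0) (hK k (p - pi / 2) k0 _ e0) => i H H'.
  by apply: nrm_brsum_mode => _ [->|->].
have pos_near : \forall n \near \oo, forall m : 'I_N, small m.+1%:Z n.
  by apply: filter_forall => m; exact: osc_near.
have neg_near : \forall n \near \oo, forall m : 'I_N, small (- m.+1%:Z) n.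
  by apply: filter_forall => m; exact: osc_near.
have lim_near : \forall n \near \oo, nrm (brsum n h - v) <= e.
  move/cvg_nrm : hv => /cvgr0_norm_le/(_ _ e0).
  by apply: filterS => i; rewrite ger0_norm ?nrm_ge0.
have mass_near : \forall n \near \oo, `|1 - rsum n (@wbar R)| <= e.
  by move/cvgrPdist_le : rsum_wbar_cvg; apply.
have [n [[n0 h1] [h3 [h4 h5]]]] := filter_ex (filterI
  (filterI (nbhs_infty_gt 0) lim_near)
  (filterI mass_near (filterI pos_near neg_near))).
have h2 : nrm (brsum n h - brsum n hN) <= c * e.
  apply: brsum_dist_le => // x; rewrite -scalerBr nrmZ.
  by apply: ler_pM => //; [exact: nrm_ge0|exact: normr_wbar_le|exact: fN].
have h6 : nrm (brsum n hN - A) <= e * nrm A + 2 * c * (K + e) * S.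
  have -> : brsum n hN - A = (rsum n (@wbar R) - 1)%:C *: A +
      \sum_(m < N) (brsum n (gm m.+1%:Z) + brsum n (gm (- m.+1%:Z))).
    by rewrite hNE rmorphB /= scalerBl scale1r addrAC.
  apply: le_trans (nrmD _ _) _; apply: lerD.
    by rewrite nrmZ distrC ler_wpM2r ?nrm_ge0.
  apply: le_trans (nrm_sum _ _ _) _.
  apply: (@le_trans _ _ (\sum_(m < N) 2 * c * (K + e) * pair_norm f m)).
    apply: ler_sum => m _; apply: le_trans (nrmD _ _) _.
    by rewrite /pair_norm mulrDr; apply: lerD; [exact: h4|exact: h5].
  by rewrite -mulr_sumr ler_wpM2l// !mulr_ge0// ltW.
have -> : 2 * c * K * S + d = e + (c * e + (e * nrm A + 2 * c * (K + e) * S)).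
  have -> : d = e * C by rewrite /e divfK ?gt_eqF.
  by rewrite /C; ring.
apply: le_trans (nrm_dist_triangle (brsum n h) _ _) _.
apply: lerD; first by rewrite nrm_distC.
by apply: le_trans (nrm_dist_triangle (brsum n hN) _ _) _; apply: lerD.
Qed.

End Average.

(** With y = T^(1/4) and m the least integer above y one has 2m <= 4y, so the left
    side is at most 64 e y^3, which is below r y^4 = r T; this holds once
    y >= 1 and y >= 64 e / r. *)
Lemma exp_decay_eventually (R : realType) (r : R) : 0 < r ->
  \forall T \near +oo, exists2 m : nat, (0 < m)%N &
    (expR 1 * m.*2%:R ^+ 3 <= r * T) /\ T `^ (4^-1) <= m%:R.
Proof.
move=> r0; pose Y := 64 * expR 1 / r.
have Y0 : 0 < Y by rewrite divr_gt0// mulr_gt0 ?expR_gt0.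
near=> T.
have T1 : 1 <= T by near: T; apply: nbhs_pinfty_ge; exact: num_real.
have TY : Y ^+ 4 <= T by near: T; apply: nbhs_pinfty_ge; exact: num_real.
pose y := T `^ (4^-1).
have y40 : y ^+ 4 = T.
  rewrite -powR_mulrn ?powR_ge0// -powRrM mulVf// powRr1//.
have y1 : 1 <= y.
  by rewrite -(@ler_pXn2r _ 4) ?nnegrE ?powR_ge0// y40 expr1n.
have yY : Y <= y.
  by rewrite -(@ler_pXn2r _ 4) ?nnegrE ?powR_ge0 ?(ltW Y0)// y40.
exists (Num.truncn y).+1 => //; split; last first.
  by apply: ltW; apply: real_truncnS_gt; exact: num_real.
have my : (Num.truncn y).+1%:R <= 2 * y.
  rewrite -natr1 mulr_natl mulr2n lerD//.
  by rewrite truncn_le (le_trans ler01).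
rewrite -muln2 natrM exprMn.
apply: (@le_trans _ _ (expR 1 * ((2 * y) ^+ 3 * 2 ^+ 3))).
  rewrite ler_pM2l ?expR_gt0// ler_wpM2r ?exprn_ge0//.
  by rewrite lerXn2r// nnegrE// mulr_ge0// (le_trans ler01).
rewrite -y40.
have -> : expR 1 * ((2 * y) ^+ 3 * 2 ^+ 3) = Y * r * y ^+ 3.
  by rewrite /Y divfK ?gt_eqF//; ring.
rewrite (mulrC Y) -mulrA ler_pM2l// [leRHS]exprS ler_wpM2r//.
by rewrite exprn_ge0// (le_trans ler01).
Unshelve. all: by end_near. Qed.

Unset Implicit Arguments.

Theorem theorem3p10 (R : realType) (B : completeNormedModType R[i])
    (Delta : R -> R) (f : R -> B) (rho : R)
    (hDelta : approximation_function Delta)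
    (hf : in_B_Delta Delta f)
    (hrho : nonresonant_continuous rho)
    (hsum : (\esum_(k in [set k : int | k != 0%R])
               ((Delta (`|k|%:~R))^-1)%:E < +oo)%E) :
  exists c C8 : R, [/\ 0 < c, 0 < C8 &
    \forall T \near +oo, forall theta : R,
      bochner_integrable lebesgue_measure `[0, T]
        (fun t => (wbar (t / T))%:C *: f (rho * t + theta)) /\
      `| (T^-1)%:C *:
           bochner_integral lebesgue_measure `[0, T]
             (fun t => (wbar (t / T))%:C *: f (rho * t + theta))
         - circle_integral f |
        <= (C8 * expR (- (T `^ c)))%:C].
Proof.
have rho0 : 0 < `|rho|.
  rewrite normr_gt0; apply/eqP => rho0.
  have [] := hrho; rewrite rho0 => irr0 _; apply: irr0.
  by exists 0 => //; rewrite rmorph0.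
have [S S0 hS] := pair_norm_summable hDelta hf hsum.
have mass0 : 0 < (bump_mass R)^-1 by rewrite invr_gt0 bump_mass_gt0.
have r0 : 0 < 2 * pi * `|rho| by rewrite !mulr_gt0 ?pi_gt0.
exists 4^-1, (2 * (bump_mass R)^-1 * (S + 1)); split.
- by rewrite invr_gt0.
- by rewrite !mulr_gt0// ltr_wpDl.
near=> T => theta.
have T0 : 0 < T by near: T; apply: nbhs_pinfty_gt; exact: num_real.
have muD : (@lebesgue_measure R `[0%R, T]%classic < +oo)%E.
  by rewrite lebesgue_measure_itv /= lte_fin T0 ltry.
have [m m0 [mT yT]] : exists2 m : nat, (0 < m)%N &
    (expR 1 * m.*2%:R ^+ 3 <= 2 * pi * `|rho| * T) /\ T `^ (4^-1) <= m%:R.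
  by near: T; exact: exp_decay_eventually.
have gE : (fun t => (wbar (t / T))%:C *: f (rho * t + theta)) =
    (fun t => (fun x => (wbar x)%:C *: f (rho * T * x + theta)) (t / T)).
  by apply/funext => t /=; rewrite -mulrA (mulrCA T) divff ?mulr1 ?gt_eqF.
have uh := unif_cont_average hDelta hf hsum (rho * T) theta.
have [v [iv hv]] := is_bochner_integral_unif_cont T0 uh.
(* the integral over [0, T] is T times the limit of Riemann sums over [0, 1] *)
rewrite gE; split; first by exists (T%:C *: v).
have -> : bochner_integral lebesgue_measure `[0, T]
    (fun t => (fun x => (wbar x)%:C *: f (rho * T * x + theta)) (t / T)) = T%:C *: v.
  rewrite /bochner_integral; case: xgetP => [w _ iw|/(_ (T%:C *: v))]; last by [].
  apply: is_bochner_integral_unique iw iv.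
  - exact: measurable_itv.
  - exact: muD.
  - exact: (unif_cont_nrm_measurable T0 uh).
rewrite scalerA -rmorphM /= mulVf ?gt_eqF// scale1r normr_nrm lecR.
have := average_bound hDelta hf hsum _ hv hS.
move=> /(_ (expR (- m%:R))) H.
apply: (le_trans (H _)).
  move=> k p k0; apply: osc_decay => //; apply: le_trans mT _.
  rewrite !normrM (gtr0_norm (pi_gt0 R)) (gtr0_norm T0) normr_nat.
  rewrite mulrA ler_pM2r// ler_pM2r// ler_peMr ?mulr_ge0 ?pi_ge0//.
  by rewrite -intr_norm ler1z -gtz0_ge1 normr_gt0.
rewrite -!mulrA !ler_pM2l// mulrC ler_pM ?expR_ge0//; first by rewrite lerDl.
by rewrite ler_expR lerN2.
Unshelve. all: by end_near. Qed.
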